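(* Let $(X,T)$ be a topological dynamical system satisfying the specification property, let $\mathcal{F}=\{f_n\}_{n\ge1}$ and $\Phi=\{\varphi_n\}_{n\ge1}$ be asymptotically additive potentials on $X$, and let $\mathcal{G}=\{g_n\}_{n\ge1}$ and $\Psi=\{\psi_n\}_{n\ge1}$ be asymptotically additive potentials on $X$ for which there is a constant $\sigma>0$ with $\frac1n g_n(x)\ge\sigma$ and $\frac1n\psi_n(x)\ge\sigma$ for all $n\in\mathbb{N}$, $x\in X$. Assume $\inf_{\mu\in\mathcal{M}_T}\frac{\Phi_*(\mu)}{\Psi_*(\mu)}<\sup_{\mu\in\mathcal{M}_T}\frac{\Phi_*(\mu)}{\Psi_*(\mu)}$. Then $$\sup\Big\{\frac{\mathcal{F}_*(\mu)}{\mathcal{G}_*(\mu)}:\mu\in\mathcal{E}_T\Big\}=\sup\Big\{\frac{\mathcal{F}_*(\mu)}{\mathcal{G}_*(\mu)}:\mu\in\mathcal{M}_T\Big\}=\sup\Big\{\frac{\mathcal{F}_*(\mu)}{\mathcal{G}_*(\mu)}:\mu\in\bigcup_{x\in\widehat{X}_{\Phi,\Psi}}\mathcal{V}(x)\Big\}=\sup_{x\in\widehat{X}_{\Phi,\Psi}}\limsup_{n\to\infty}\frac{f_n(x)}{g_n(x)}.$$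
   Context: $X$ is a compact metric space with metric $d$ and $T:X\to X$ is continuous. $\mathcal{M}_T$ denotes the set of $T$-invariant Borel probability measures on $X$ and $\mathcal{E}_T$ the ergodic ones. For $f\in C(X)$, $S_nf=\sum_{i=0}^{n-1}f\circ T^i$. A sequence $\mathcal{F}=\{f_n\}_{n\ge1}\subset C(X)$ is an asymptotically additive potential (AAP) if for every $\xi>0$ there is $f_\xi\in C(X)$ with $\limsup_{n\to\infty}\frac1n\|f_n-S_nf_\xi\|_\infty<\xi$; for $\mu\in\mathcal{M}_T$, $\mathcal{F}_*(\mu)=\lim_{n\to\infty}\frac1n\int f_n\,d\mu$ (this limit exists). $\widehat{X}_{\Phi,\Psi}=\{x\in X:\lim_{n\to\infty}\varphi_n(x)/\psi_n(x)\text{ does not exist}\}$. For $x\in X$, $\mathcal{V}(x)$ is the set of weak$^*$ limit points of $\delta_{x,n}=\frac1n\sum_{i=0}^{n-1}\delta_{T^ix}$. $(X,T)$ has the specification property if for every $\epsilon>0$ there is an integer $m(\epsilon)$ such that for any finite collection of intervals $[a_j,b_j]\subset\mathbb{N}$, $j=1,\dots,k$, with $a_{j+1}-b_j\ge m(\epsilon)$ for $j=1,\dots,k-1$, and any $x_1,\dots,x_k\in X$, there is $x\in X$ with $d(T^{p+a_j}x,T^px_j)<\epsilon$ for all $p=0,1,\dots,b_j-a_j$ and all $j$. *)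

(* Defs.v *)
From HB Require Import structures.
From mathcomp Require Import all_boot all_order all_algebra.
From mathcomp Require Import all_classical all_reals all_analysis.
Set Implicit Arguments. Unset Strict Implicit. Unset Printing Implicit Defensive.
Import Order.TTheory GRing.Theory Num.Theory.
Import numFieldTopology.Exports numFieldNormedType.Exports.
Local Open Scope classical_set_scope.
Local Open Scope ring_scope.

(* Measurable types in MathComp-Analysis must be pointed (nonempty); we
   equip X with a chosen point x0. *)
Definition pointed_at (X : Type) (x0 : X) : Type := X.
HB.instance Definition _ (X : choiceType) (x0 : X) :=
  Choice.on (pointed_at x0).
HB.instance Definition _ (X : choiceType) (x0 : X) :=
  isPointed.Build (pointed_at x0) x0.

Definition borel (X : topologicalType) (x0 : X) :=
  g_sigma_algebraType (@open X : set (set (pointed_at x0))).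

Section Dyn.
Context {R : realType} {X : metricType R} {x0 : X}.

Definition birkhoff (T : X -> X) (h : X -> R) (n : nat) (x : X) : R :=
  \sum_(i < n) h (iter i T x).

Definition specification (T : X -> X) : Prop :=
  forall eps : R, 0 < eps -> exists m : nat,
    forall (k : nat) (a b : nat -> nat) (xs : nat -> X),
      (forall j, (j < k)%N -> (a j <= b j)%N) ->
      (forall j, (j.+1 < k)%N -> (b j + m <= a j.+1)%N) ->
      exists x : X, forall j, (j < k)%N -> forall p, (p <= b j - a j)%N ->
        mdist (iter (p + a j) T x) (iter p T (xs j)) < eps.

(* Asymptotically additive potential F = {F n}_{n>=1} (the value F 0 is unused). *)
Definition AAP (T : X -> X) (F : nat -> X -> R) : Prop :=
  (forall n, (0 < n)%N -> continuous (F n)) /\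
  forall xi : R, 0 < xi -> exists h : X -> R, continuous h /\
    (limn_esup (fun n : nat => ((n%:R)^-1)%:E *
        ereal_sup (range (fun x => (`|F n x - birkhoff T h n x|)%:E)))
      < xi%:E)%E.

Definition Fstar (F : nat -> X -> R) (mu : probability (borel x0) R) : R :=
  limn (fun n : nat => (n%:R)^-1 * Rintegral mu setT (F n)).

Definition T_invariant (T : X -> X) (mu : probability (borel x0) R) : Prop :=
  forall A : set (borel x0), measurable A -> mu (T @^-1` A) = mu A.

Definition ergodic (T : X -> X) (mu : probability (borel x0) R) : Prop :=
  T_invariant T mu /\
  forall A : set (borel x0), measurable A -> T @^-1` A = A ->
    mu A = 0%E \/ mu A = 1%E.

Definition Xhat (phi psi : nat -> X -> R) : set X :=
  [set x | ~ exists l : R, (fun n : nat => phi n x / psi n x) @ \oo --> l].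

(* mu in V(x): mu is a weak* limit (cluster) point of the empirical measures
   delta_{x,n} = (1/n) sum_{i<n} delta_{T^i x}, i.e. every basic weak*
   neighbourhood of mu contains delta_{x,n} for infinitely many n. *)
Definition Vset (T : X -> X) (x : X) (mu : probability (borel x0) R) : Prop :=
  forall (k : nat) (h : 'I_k -> X -> R), (forall i, continuous (h i)) ->
  forall eps : R, 0 < eps -> forall N : nat, exists n : nat,
    [/\ (N <= n)%N, (0 < n)%N &
      forall i, `| (n%:R)^-1 * birkhoff T (h i) n x - Rintegral mu setT (h i) | < eps].

End Dyn.

(* Main.v *)
(** Call the four suprema S1 (ergodic measures), S2 (invariant measures), S3 (the
    sets V(x)) and S4 (pointwise upper limits). Comparing F_*/G_* with a constant c
    amounts to the sign of K_* for the asymptotically additive K = F - cG, and K is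
    approximated by Birkhoff sums of a single continuous function h.

    S2 <= S1: the integral of h is maximized by an ergodic measure, obtained by
    maximizing lexicographically h and then a countable family of continuous
    functions that determines measures; the maximizer is an extreme invariant measure.

    S2 <= S4: three sequences of orbit segments witness c < F_*/G_*, Phi_*/Psi_* < a
    and b < Phi_*/Psi_* with a < b. By specification one point tracks, up to a fixed
    error, arbitrarily long segments of all three kinds in turn, each much longer
    than the time elapsed before it; its quotients phi_n/psi_n oscillate across
    [a, b] and f_n/g_n exceeds c infinitely often.

    S4 <= S3: empirical measures along a subsequence converge along an ultrafilter to
    a positive functional on C(X), which the Riesz theorem turns into a measure. Its
    outer measure covers a set by countably many sets A weighted by
    inf {L h : h >= 1_A continuous}.

    S3 <= S2 holds because the measures in V(x) are invariant. *)
Require Import Defs.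
From HB Require Import structures.
From mathcomp Require Import all_boot all_order all_algebra.
From mathcomp Require Import all_classical all_reals all_analysis.
From mathcomp Require Import measurable_realfun ring lra.
Import Order.TTheory GRing.Theory Num.Theory.
Import numFieldTopology.Exports numFieldNormedType.Exports.
Local Open Scope classical_set_scope.
Local Open Scope ring_scope.

Set Implicit Arguments. Unset Strict Implicit. Unset Printing Implicit Defensive.

(** * Compact metric spaces *)

Lemma mdist_lipschitz {R : realType} {X : metricType R} (c x y : X) :
  `|mdist c x - mdist c y| <= mdist x y.
Proof.
have := metric_triangle c x y; have := metric_triangle c y x.
by rewrite (metric_sym y x) => ? ?; rewrite ler_norml; apply/andP; split; lra.
Qed.

Lemma continuous_mdist {R : realType} {X : metricType R} (c : X) :
  continuous (mdist c : X -> R).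
Proof.
move=> x; apply/cvgrPdist_le => e e0.
near=> y; apply: le_trans (mdist_lipschitz _ _ _) _.
by near: y; exact: (metricType_numDomainType.cvgr_dist_le (@cvg_id _ _)).
Unshelve. all: by end_near. Qed.

Lemma compact_bounded_fun {R : realType} {X : topologicalType} (h : X -> R) :
  compact [set: X] -> continuous h -> exists2 M, 0 < M & forall x, `|h x| <= M.
Proof.
move=> cX ch.
have : compact (h @` setT) by apply: continuous_compact => //; exact: continuous_subspaceT.
move=> /compact_bounded[M [Mr HM]]; exists (`|M| + 1); first by rewrite ltr_wpDl.
move=> x; apply: (HM (`|M| + 1)); last by exists x.
by rewrite (le_lt_trans (ler_norm _))// ltrDl.
Qed.

(** The [w i] are tents of radius 1/(n+1) centred at the points of finite nets, enumerated by pairs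
    of a scale and a position in the net. They reduce open sets to countably many cozero sets. *)
Lemma cozero_base {R : realType} {X : metricType R} (x0 : X) :
  compact [set: X] -> exists w : nat -> X -> R,
    [/\ forall i, continuous (w i), forall i x, 0 <= w i x &
     forall V x, open V -> V x ->
       exists2 i, 0 < w i x & forall y, 0 < w i y -> V y].
Proof.
move=> cX.
(* Finite nets come from compactness applied along the filter of finite lists ordered by
   inclusion. *)
have H n : exists s : seq X, forall x, exists2 c, c \in s & mdist c x < (n.+1%:R : R)^-1.
  have r0 : 0 < (n.+1%:R : R)^-1 by rewrite invr_gt0.
  pose F := filter_from [set: seq X] (fun s => [set t : seq X | {subset s <= t}]).
  have FF : ProperFilter F.
    apply: filter_from_proper; last by move=> s _; exists s => ?.
    apply: filter_from_filter; first by exists [::].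
    move=> s t _ _; exists (s ++ t) => // u stu.
    by split=> y ys; apply: stu; rewrite mem_cat ys ?orbT.
  have /compact_near_coveringP/(_ _ F (fun s x => exists2 c, c \in s & mdist c x < (n.+1%:R : R)^-1)) := cX.
  case/(_ _ _)/filter_ex => [x _|s sX]; last by exists s => x; exact: sX.
  exists (ball x (n.+1%:R : R)^-1, [set t : seq X | x \in t]) => /=.
    split; first exact: nbhsx_ballx.
    by exists [:: x] => // t; apply; rewrite mem_head.
  by move=> [y t] /= []; rewrite ballEmdist /= => yx xt; exists x.
have /choice[s sP] := H.
pose w (i : nat) (x : X) : R := if unpickle i is Some (n, j) then
  Num.max 0 ((n.+1%:R)^-1 - mdist (nth x0 (s n) j) x) else 0.
exists w; split.
- move=> i; rewrite /w; case: (unpickle i) => [[n j]|]; last exact: cst_continuous.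
  move=> x; apply: (@continuous_max R X (cst 0)); first exact: cvg_cst.
  by apply: cvgB; [exact: cvg_cst|exact: continuous_mdist].
- by move=> i x; rewrite /w; case: (unpickle i) => [[n j]|] //; rewrite le_max lexx.
move=> V x oV Vx.
have /metricType_numDomainType.nbhs_mdistP[e /= e0 eV] : nbhs x V by exact: open_nbhs_nbhs.
(* A net point closer than 1/(n+1) < e/2 to [x] carries a tent supported in the ball of radius [e]
   around [x]. *)
have e20 : 0 < e / 2 by rewrite divr_gt0.
have [//|n] := @ltr_add_invr R 0 (e / 2) _; rewrite add0r => ne.
have [c /[dup] cs /(nthP x0)[j js jc] cx] := sP n x.
exists (pickle (n, j)); rewrite /w pickleK; first by rewrite lt_max jc subr_gt0 cx orbT.
move=> y; rewrite jc lt_max ltxx /= subr_gt0 => cy.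
apply: eV; rewrite /=; have := metric_triangle x c y; rewrite (metric_sym x c).
move: cx cy ne => cx cy ne xy.
have := ltrD cx cy => cxy; rewrite (le_lt_trans xy) // (lt_trans cxy) //.
by rewrite [ltRHS]splitr ltrD.
Qed.

(** * Positive functionals on continuous functions *)

(** One interface for integrals, empirical averages and their ultralimits. The laws are asked only
    of continuous functions, where all three satisfy them. *)
Record prob_functional (R : realType) (X : topologicalType) := ProbFunctional {
  pf_fun :> (X -> R) -> R ;
  pfD : forall h k : X -> R, continuous h -> continuous k ->
    pf_fun (fun x => h x + k x) = pf_fun h + pf_fun k ;
  pfZ : forall (c : R) (h : X -> R), continuous h -> pf_fun (fun x => c * h x) = c * pf_fun h ;
  pf_ge0 : forall h : X -> R, continuous h -> (forall x, 0 <= h x) -> 0 <= pf_fun h ;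
  pf1 : pf_fun (fun=> 1) = 1 }.

Arguments pfD {R X} _ [h k].
Arguments pfZ {R X} _ c [h].
Arguments pf_ge0 {R X} _ [h].

Section continuous_ops.
Context {R : realType} {X : topologicalType}.
Implicit Types h k : X -> R.

Lemma continuousD_fun h k : continuous h -> continuous k ->
  continuous (fun x => h x + k x).
Proof. by move=> ch ck x; apply: cvgD; [exact: ch|exact: ck]. Qed.

Lemma continuousM_fun h k : continuous h -> continuous k ->
  continuous (fun x => h x * k x).
Proof. by move=> ch ck x; apply: cvgM; [exact: ch|exact: ck]. Qed.

Lemma continuousZ_fun c h : continuous h -> continuous (fun x => c * h x).
Proof. by move=> ch; apply: continuousM_fun => //; exact: cst_continuous. Qed.

Lemma continuousB_fun h k : continuous h -> continuous k ->
  continuous (fun x => h x - k x).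
Proof. by move=> ch ck x; apply: cvgB; [exact: ch|exact: ck]. Qed.

Lemma continuous_sum_fun n (h : nat -> X -> R) : (forall i, continuous (h i)) ->
  continuous (fun x => \sum_(i < n) h i x).
Proof.
move=> ch; elim: n => [|n ih].
  by under eq_fun do rewrite big_ord0; exact: cst_continuous.
by under eq_fun do rewrite big_ord_recr /=; exact: continuousD_fun.
Qed.

End continuous_ops.

Section prob_functional_theory.
Context {R : realType} {X : topologicalType} (L : prob_functional R X).
Implicit Types h k : X -> R.

Lemma pf_cst c : L (fun=> c) = c.
Proof.
rewrite -[RHS]mulr1 -(pf1 L) -pfZ; last exact: cst_continuous.
by congr (L _); apply/funext => x; rewrite mulr1.
Qed.

Lemma pfB h k : continuous h -> continuous k ->
  L (fun x => h x - k x) = L h - L k.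
Proof.
move=> ch ck; rewrite -[- L k]mulN1r -(pfZ L) // -pfD //; last exact: continuousZ_fun.
by congr (L _); apply/funext => x; rewrite mulN1r.
Qed.

Lemma pf_le h k : continuous h -> continuous k -> (forall x, h x <= k x) ->
  L h <= L k.
Proof.
move=> ch ck hk; rewrite -subr_ge0 -pfB //; apply: pf_ge0.
  exact: continuousB_fun.
by move=> x; rewrite subr_ge0.
Qed.

Lemma pf_sum n (h : nat -> X -> R) : (forall i, continuous (h i)) ->
  L (fun x => \sum_(i < n) h i x) = \sum_(i < n) L (h i).
Proof.
move=> ch; elim: n => [|n ih].
  by under eq_fun do rewrite big_ord0; rewrite big_ord0 pf_cst.
under eq_fun do rewrite big_ord_recr /=.
by rewrite big_ord_recr /= -ih pfD //; exact: continuous_sum_fun.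
Qed.

Lemma pf_norm_le h M : continuous h -> (forall x, `|h x| <= M) -> `|L h| <= M.
Proof.
move=> ch hM; rewrite ler_norml -[X in X <= _]pf_cst -[X in _ && (_ <= X)]pf_cst.
by apply/andP; split; apply: pf_le => //;
  try exact: cst_continuous; move=> x; have := hM x; rewrite ler_norml => /andP[].
Qed.

End prob_functional_theory.

(** * Integrals of continuous functions against Borel probabilities *)

Section borel_integral.
Context {R : realType} {X : metricType R} (x0 : X).

Lemma borel_open (V : set X) : open V -> measurable (V : set (borel x0)).
Proof. by move=> oV; exact: sub_sigma_algebra. Qed.

Lemma continuous_borel (h : X -> R) : continuous h ->
  measurable_fun setT (h : borel x0 -> R).
Proof.
move=> ch; apply: (measurability _ (RGenOInfty.measurableE R)).
move=> _ [_ [y ->] <-]; rewrite setTI; apply: borel_open.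
by apply: open_comp => [x _|]; [exact: ch|exact: rray_open].
Qed.

Lemma continuous_borel_map (T : X -> X) : continuous T ->
  measurable_fun setT (T : borel x0 -> borel x0).
Proof.
move=> cT; apply: (@measurability _ _ (borel x0) (borel x0) setT T (@open X)) => //.
move=> _ [V oV <-]; rewrite setTI; apply: borel_open.
by apply: open_comp => // x _; exact: cT.
Qed.

Hypothesis cX : compact [set: X].
Variable P : probability (borel x0) R.
Implicit Types h k : X -> R.

Lemma continuous_integrable h : continuous h ->
  P.-integrable setT (EFin \o (h : borel x0 -> R)).
Proof.
move=> ch; have [M M0 hM] := compact_bounded_fun cX ch.
apply: measurable_bounded_integrable => //.
- by rewrite (@le_lt_trans _ _ 1%E) ?ltry // probability_le1.
- exact: continuous_borel.
- exists M; split; first exact: num_real.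
  by move=> y My x _ /=; rewrite (le_trans (hM x))// ltW.
Qed.

Definition integral_functional : prob_functional R X.
Proof.
apply: (@ProbFunctional R X (fun h => Rintegral P setT h)).
- by move=> h k ch ck; apply: RintegralD => //; exact: continuous_integrable.
- by move=> c h ch; apply: RintegralZl => //; exact: continuous_integrable.
- by move=> h ch h0; exact: Rintegral_ge0.
- rewrite Rintegral_cst // mul1r; have := @probability_setT _ _ _ P.
  by move=> /(congr1 fine).
Defined.

End borel_integral.

Arguments borel_open {R X} x0 [V].
Arguments continuous_borel {R X} x0 [h].
Arguments continuous_borel_map {R X} x0 [T].

(** * The Riesz representation theorem *)

Section Riesz.
Context {R : realType} {X : metricType R} (x0 : X) (L : prob_functional R X).
Implicit Types (A B : set (borel x0)) (h : X -> R).

Definition dominating A : set (X -> R) :=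
  [set h : X -> R | [/\ continuous h, forall x, 0 <= h x & forall x, A x -> 1 <= h x]].

(** A set has the capacity of its closure, so countable subadditivity fails in general;
    [riesz_outer] restores it by passing to countable covers. *)
Definition capacity A : \bar R := ereal_inf [set (L h)%:E | h in dominating A].

Lemma capacity_ge0 A : (0 <= capacity A)%E.
Proof.
apply: le_ereal_inf_tmp => _ [h [ch h0 _] <-].
by rewrite lee_fin; exact: pf_ge0.
Qed.

Lemma capacity_le A h : dominating A h -> (capacity A <= (L h)%:E)%E.
Proof. by move=> Ah; apply: ereal_inf_lbound; exists h. Qed.

Lemma capacity_fin A : capacity A \is a fin_num.
Proof.
rewrite ge0_fin_numE ?capacity_ge0 //.
apply: le_lt_trans (capacity_le (h := cst 1) _) (ltry _).
by split=> //; exact: cst_continuous.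
Qed.

Lemma capacity0 : capacity set0 = 0%E.
Proof.
apply/eqP; rewrite eq_le capacity_ge0 andbT -[X in (_ <= X%:E)%E](pf_cst L 0).
by apply: capacity_le; split=> //; exact: cst_continuous.
Qed.

Definition riesz_outer : set (borel x0) -> \bar R := mu_ext capacity.

HB.instance Definition _ := isOuterMeasure.Build R (borel x0) riesz_outer
  (mu_ext0 capacity0 capacity_ge0) (mu_ext_ge0 capacity_ge0)
  (le_mu_ext capacity) (mu_ext_sigma_subadditive capacity_ge0).

(** Covers must consist of measurable sets, so [A] is enlarged to the set where [h] is at least 1,
    which the same [h] dominates. *)
Lemma riesz_outer_le A h : dominating A h -> (riesz_outer A <= (L h)%:E)%E.
Proof.
move=> [ch h0 h1]; pose C : set (borel x0) := [set x | 1 <= h x].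
have mC : measurable C.
  have := continuous_borel x0 ch measurableT.
  move=> /(_ `[1, +oo[%classic (measurable_itv _)); rewrite setTI.
  by congr measurable; apply/seteqP; split => x; rewrite /C /= in_itv /= andbT.
apply: le_trans (capacity_le (A := C) (h := h) _); last by split.
apply: ereal_inf_lbound; exists (fun n => if n is 0%N then C else set0).
  by split=> [[|n]|x /h1 ?]; [|exact: measurable0|exists 0%N].
apply/cvg_lim => //; rewrite -cvg_shiftS.
rewrite (_ : [sequence _]_n = cst (capacity C)); first exact: cvg_cst.
by rewrite funeqE => n /=; rewrite big_nat_recl//= big1 ?adde0 // => *; exact: capacity0.
Qed.

Section cutoff.
Variables (rho : X -> R) (crho : continuous rho) (rho0 : forall x, 0 <= rho x).

Definition cozero : set (borel x0) := [set x | 0 < rho x].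

Lemma measurable_cozero : measurable cozero.
Proof.
have := continuous_borel x0 crho measurableT.
move=> /(_ `]0, +oo[%classic (measurable_itv _)); rewrite setTI.
by congr measurable; apply/seteqP; split => x; rewrite /cozero /= in_itv /= andbT.
Qed.

(** Zero where [rho] is at most 2^-k and one where it is at least 2^(1-k). Thus wherever
    [cutoff k.+1] is still below 1, [cutoff k] vanishes. *)
Definition cutoff k (x : X) : R := Num.min 1 (Num.max 0 (2 ^+ k * rho x - 1)).

Lemma continuous_cutoff k : continuous (cutoff k).
Proof.
move=> x; apply: (@continuous_min R X (cst 1)); first exact: cvg_cst.
apply: (@continuous_max R X (cst 0)); first exact: cvg_cst.
apply: cvgB; last exact: cvg_cst.
by apply: continuousZ_fun.
Qed.

Lemma cutoff_ge0 k x : 0 <= cutoff k x.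
Proof. by rewrite /cutoff le_min ler01 le_max lexx. Qed.

Lemma cutoff_le1 k x : cutoff k x <= 1.
Proof. by rewrite /cutoff ge_min lexx. Qed.

Lemma cutoff_eq0 k x : rho x = 0 -> cutoff k x = 0.
Proof.
move=> r0; rewrite /cutoff r0 mulr0 sub0r.
by rewrite (max_idPl _) ?lerN10 // (min_idPr _).
Qed.

Lemma cutoffS k x : cutoff k x <= cutoff k.+1 x.
Proof.
have := mulr_ge0 (exprn_ge0 k (ler0n R 2)) (rho0 x).
rewrite /cutoff exprS -mulrA; set t := 2 ^+ k * _ => t0.
by rewrite !minElt !maxElt; repeat case: ifP; lra.
Qed.

Lemma cutoff_step k x : cutoff k.+1 x < 1 -> cutoff k x = 0.
Proof.
rewrite /cutoff exprS -mulrA; set t := 2 ^+ k * _.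
by rewrite !minElt !maxElt; repeat case: ifP; lra.
Qed.

Lemma cutoff_eventually x : 0 < rho x -> exists k, cutoff k x = 1.
Proof.
move=> r0; exists (Num.truncn (2 / rho x)).+1.
set k := _.+1; have : 2 / rho x < k%:R by exact: truncnS_gt.
rewrite ltr_pdivrMr // => kr.
have : (k%:R : R) <= 2 ^+ k by rewrite -natrX ler_nat ltnW // ltn_expl.
move/(ler_wpM2r (ltW r0)) => kk.
rewrite /cutoff (max_idPr _); last by lra.
by rewrite (min_idPl _) //; lra.
Qed.

(* [h * cutoff k] increases with [k]; the pieces of [B] where the cutoff has just
   reached 1 are dominated by differences of these functions two steps apart, and
   these telescope. *)
Lemma riesz_outer_split B h : dominating B h ->
  (riesz_outer (B `&` cozero) + riesz_outer (B `&` ~` cozero) <= (L h)%:E)%E.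
Proof.
move=> [ch h0 h1]; set V := cozero.
pose u k x := h x * cutoff k x.
have cu k : continuous (u k) by apply: continuousM_fun => //; exact: continuous_cutoff.
have uS k x : u k x <= u k.+1 x by rewrite ler_wpM2l // cutoffS.
pose a k := L (u k).
have aS k : a k <= a k.+1 by exact: pf_le.
have a_nd : {homo a : n m / (n <= m)%N >-> n <= m} by apply/nondecreasing_seqP.
have aL k : a k <= L h.
  by apply: pf_le => // x; rewrite ler_piMr // cutoff_le1.
have supa : has_sup (range a).
  by split; [exists (a 0%N), 0%N|exists (L h) => _ [k _ <-]; exact: aL].
pose s := sup (range a).
have as_ k : a k <= s by apply: ub_le_sup; [exact: supa.2|exists k].
have out m : (riesz_outer (B `&` ~` V) <= (L h - a m)%:E)%E.
  rewrite /a -pfB //; apply: riesz_outer_le; split.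
  - exact: continuousB_fun.
  - by move=> x; rewrite subr_ge0 ler_piMr // cutoff_le1.
  - move=> x [Bx /negP]; rewrite -leNgt => r0.
    have : rho x = 0 by apply/eqP; rewrite eq_le r0 rho0.
    by move=> /(cutoff_eq0 m); rewrite /u => ->; rewrite mulr0 subr0; exact: h1.
have inn m : (riesz_outer (B `&` V) <= (2 * s - a m)%:E)%E.
  pose C j : set (borel x0) := if j is j'.+1 then
    B `&` [set x | cutoff (m + j').+2 x = 1 /\ cutoff (m + j').+1 x < 1]
    else B `&` [set x | cutoff m.+1 x = 1].
  have BC : B `&` V `<=` \bigcup_j C j.
    move=> x [Bx Vx]; have [k k1] := cutoff_eventually Vx.
    have : exists k, cutoff (m + k).+1 x == 1.
      exists k; apply/eqP/le_anti; rewrite cutoff_le1 /= -k1.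
      have : {homo (fun k => cutoff k x) : n m / (n <= m)%N >-> n <= m}.
        by apply/nondecreasing_seqP => ?; exact: cutoffS.
      by apply; rewrite -addnS ltnW // addnS ltnS leq_addl.
    case/ex_minnP => -[|j] /eqP j1 jmin.
      by exists 0%N => //; split=> //; move: j1; rewrite addn0.
    exists j.+1 => //; split=> //; split; first by rewrite -addnS.
    rewrite lt_neqAle cutoff_le1 andbT; apply/negP => /jmin.
    by rewrite ltnn.
  apply: le_trans (le_outer_measure riesz_outer _ _ BC) _.
  apply: le_trans (outer_measure_sigma_subadditive riesz_outer C) _.
  apply: lime_le.
    by apply: is_cvg_nneseries => *; exact: outer_measure_ge0.
  apply: nearW => n; pose b j := if j is j'.+1 then a (m + j').+2 - a (m + j')%N else a m.+1.
  (* One extra nonnegative term lets the exceptional first layer be split off even when [n] is 0. *)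
  apply: (@le_trans _ _ (\sum_(0 <= j < n.+1) b j)%:E).
    rewrite -sumEFin big_mkord [in leRHS]big_mkord.
    apply: (@le_trans _ _ (\sum_(i < n.+1) riesz_outer (C i))%E).
      rewrite [leRHS]big_ord_recr /= leeDl //; exact: outer_measure_ge0.
    apply: lee_sum => -[[|j] jn] _ /=; rewrite /b /C /a.
      apply: riesz_outer_le; split=> //.
        by move=> x; rewrite mulr_ge0 // cutoff_ge0.
      by move=> x [Bx /= c1]; rewrite /u c1 mulr1; exact: h1.
    rewrite -pfB //; apply: riesz_outer_le; split.
    - exact: continuousB_fun.
    - by move=> x; rewrite subr_ge0; exact: le_trans (uS _ _) (uS _ _).
    - move=> x [Bx [c1 /cutoff_step c0]]; rewrite /u c0 c1 mulr0 subr0 mulr1.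
      exact: h1.
  have -> : \sum_(0 <= j < n.+1) b j = a (m + n).+1 + a (m + n)%N - a m.
    rewrite big_nat_recl //= big_mkord; elim: n => [|n ih].
      by rewrite big_ord0 addn0 addr0 addrK.
    by rewrite big_ord_recr /= addrA ih !addnS; lra.
  by rewrite lee_fin lerB // mulr_natl mulr2n lerD.
(* The two bounds add up to L h + 2 (s - a m), so an [m] with s - e/2 < a m suffices. *)
apply/lee_addgt0Pr => e e0.
have [_ [m _ <-] me] := sup_adherent (divr_gt0 e0 (ltr0n R 2)) supa.
apply: le_trans (leeD (inn m) (out m)) _.
rewrite -!EFinD lee_fin; move: me; rewrite -/s => me; lra.
Qed.

End cutoff.

End Riesz.

Arguments cozero {R X} x0 rho.
Arguments riesz_outer {R X} x0 L.
Arguments capacity {R X x0} L A.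
Arguments dominating {R X x0} A.

(** * From the outer measure to a Borel probability *)

Section Riesz_measure.
Context {R : realType} {X : metricType R} (x0 : X) (L : prob_functional R X).
Implicit Types (A B : set (borel x0)) (h rho : X -> R).
Local Notation outer := (riesz_outer x0 L).

(** [riesz_outer_split] bounds the two pieces of each member of a cover of [A] by its capacity; the
    bounds are then summed over the cover. *)
Lemma cozero_caratheodory rho : continuous rho -> (forall x, 0 <= rho x) ->
  outer.-caratheodory (cozero x0 rho).
Proof.
move=> crho rho0; apply: le_caratheodory_measurable => A; set V := cozero x0 rho.
apply: le_ereal_inf_tmp => _ [B [mB AB] <-].
have Bk k : (outer (B k `&` V) + outer (B k `&` ~` V) <= capacity L (B k))%E.
  by apply: le_ereal_inf_tmp => _ [h Bh <-]; exact: riesz_outer_split.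
have sub W : (outer (A `&` W) <= \sum_(k <oo) outer (B k `&` W))%E.
  apply: le_trans (outer_measure_sigma_subadditive outer (fun k => B k `&` W)).
  by apply: le_outer_measure; rewrite -setI_bigcupl; exact: setSI.
apply: le_trans (leeD (sub V) (sub (~` V))) _.
rewrite -nneseriesD; first last.
- by move=> *; exact: outer_measure_ge0.
- by move=> *; exact: outer_measure_ge0.
by apply: lee_nneseries => // k _; rewrite adde_ge0 ?outer_measure_ge0.
Qed.

Hypothesis cX : compact [set: X].

(** The Carathéodory sets form a sigma-algebra, and by [cozero_base] every open set is a countable
    union of cozero sets. *)
Lemma borel_caratheodory A : measurable A -> outer.-caratheodory A.
Proof.
move: A; apply: smallest_sub.
  split.
  - exact: caratheodory_measurable_set0.
  - by move=> A; rewrite setTD; exact: caratheodory_measurable_setC.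
  - exact: caratheodory_measurable_bigcup.
move=> V oV; have [w [cw w0 wV]] := cozero_base x0 cX.
pose F i : set (borel x0) :=
  if `[< forall y, 0 < w i y -> V y >] then cozero x0 (w i) else set0.
have -> : V = \bigcup_i F i.
  apply/seteqP; split=> [x /(wV _ _ oV)[i wix iV]|x [i _]].
    by exists i => //; rewrite /F asboolT.
  by rewrite /F; case: asboolP => // + wx; exact.
apply: caratheodory_measurable_bigcup => i; rewrite /F.
case: asboolP => _; last exact: caratheodory_measurable_set0.
exact: cozero_caratheodory.
Qed.

(* Dini: finitely many dominating functions already cover [h] up to [e / 2]. *)
Lemma riesz_outer_ge A h : continuous h ->
  (forall x, A x -> h x <= 1) -> (forall x, ~ A x -> h x <= 0) ->
  ((L h)%:E <= outer A)%E.
Proof.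
move=> ch hA hNA; apply: le_ereal_inf_tmp => _ [B [mB AB] <-].
apply/lee_addgt0Pr => e e0; have e20 : 0 < e / 2 by rewrite divr_gt0.
have /choice[g gP] : forall k, exists g : X -> R, dominating (B k) g /\
    ((L g)%:E <= capacity L (B k) + (e / 2 / (2 ^ k.+1)%:R)%:E)%E.
  move=> k.
  have ek : 0 < e / 2 / (2 ^ k.+1)%:R :> R by rewrite divr_gt0 // ltr0n expn_gt0.
  have [_ [h' Bh' <-] /ltW] := lb_ereal_inf_adherent ek (capacity_fin L (B k)).
  by exists h'.
have cg k : continuous (g k) by have [[]] := gP k.
have g0 k x : 0 <= g k x by have [[_ + _] _] := gP k; exact.
have cS n : continuous (fun x => \sum_(k < n) g k x) by exact: continuous_sum_fun.
(* On [A] some [g k] is at least 1, and off [A] the empty sum is enough. The slack e/2 makes the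
   inequality strict, hence valid nearby, and adding nonnegative terms preserves it. *)
have [n nh] : exists n, forall x, h x - e / 2 <= \sum_(k < n) g k x.
  have /compact_near_coveringP/(_ _ \oo
    (fun n x => h x - e / 2 <= \sum_(k < n) g k x)) := cX.
  case/(_ _ _)/filter_ex => [x _|n nh]; last by exists n => x; exact: nh.
  have [m xm] : exists m, h x - e / 2 < \sum_(k < m) g k x.
    have [Ax|nAx] := pselect (A x); last first.
      by exists 0%N; rewrite big_ord0 subr_lt0 (le_lt_trans (hNA _ nAx)).
    have [k _ Bkx] := AB _ Ax; exists k.+1; rewrite big_ord_recr /=.
    have [[_ _ /(_ _ Bkx) gk1] _] := gP k.
    have : 0 <= \sum_(i < k) g i x by exact: sumr_ge0.
    by have := hA _ Ax; lra.
  have : \forall y \near x, h y - e / 2 - \sum_(k < m) g k y < 0.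
    have : (fun y => h y - e / 2 - \sum_(k < m) g k y) y @[y --> x] -->
        h x - e / 2 - \sum_(k < m) g k x.
      by apply: cvgB; [apply: cvgB; [exact: ch|exact: cvg_cst]|exact: cS].
    by move=> /cvgr_lt; apply; rewrite subr_lt0.
  move=> near_x; exists ([set y | h y - e / 2 - \sum_(k < m) g k y < 0], [set n | (m <= n)%N]).
    by split=> //=; exists m.
  move=> [y n'] /= []; rewrite subr_lt0 => /ltW hy mn.
  rewrite (le_trans hy) // -(subnKC mn) big_split_ord /= lerDl.
  by apply: sumr_ge0 => i _; exact: (g0 (m + i)%N).
have : L h - e / 2 <= \sum_(k < n) L (g k).
  rewrite -pf_sum // -[X in _ - X](pf_cst L) -pfB //; last exact: cst_continuous.
  by apply: pf_le => //; apply: continuousB_fun => //; exact: cst_continuous.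
rewrite lerBlDr -lee_fin => /le_trans; apply; rewrite [in leRHS](splitr e) !EFinD addeA.
rewrite leeD2r // -sumEFin.
apply: le_trans (epsilon_trick _ (fun k => capacity_ge0 L (B k)) (ltW e20)).
apply: (@le_trans _ _ (\sum_(0 <= k < n) (capacity L (B k) + (e / 2 / (2 ^ k.+1)%:R)%:E))%E).
  by rewrite big_mkord; apply: lee_sum => i _; have [] := gP i.
apply: nneseries_lim_ge => k _ _; rewrite adde_ge0 ?capacity_ge0 // lee_fin.
by rewrite divr_ge0 // ltW.
Qed.

(* The proof of compactness is an argument of the definition so that the measure
   instances, which depend on it, can be inferred. *)
Definition riesz_measure of compact [set: X] : set (borel x0) -> \bar R := outer.
Local Notation mu := (riesz_measure cX).

Let riesz_measure0 : mu set0 = 0%E.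
Proof. exact: outer_measure0. Qed.

Let riesz_measure_ge0 A : (0 <= mu A)%E.
Proof. exact: outer_measure_ge0. Qed.

Let riesz_measure_sigma_additive : semi_sigma_additive mu.
Proof.
move=> F mF tF mUF; apply: (@caratheodory_measure_sigma_additive R (borel x0) outer) => //.
  by move=> i; exact: borel_caratheodory.
exact: borel_caratheodory.
Qed.

HB.instance Definition _ := isMeasure.Build _ _ _ mu
  riesz_measure0 riesz_measure_ge0 riesz_measure_sigma_additive.

Let riesz_measure1 : mu [set: borel x0] = 1%E.
Proof.
apply/eqP; rewrite eq_le -[X in (_ <= X%:E)%E](pf1 L) -[X in (X%:E <= _)%E](pf1 L).
apply/andP; split.
  by apply: riesz_outer_le; split=> //; exact: cst_continuous.
by apply: riesz_outer_ge => [|//|x]; [exact: cst_continuous|move/(_ I)].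
Qed.

HB.instance Definition _ := Measure_isProbability.Build _ _ _ mu riesz_measure1.

End Riesz_measure.
Arguments riesz_measure {R X} x0 L cX.

(** * Representing functionals and their ultralimits by measures *)

Section representation.
Context {R : realType} {X : metricType R} (x0 : X) (cX : compact [set: X]).
Implicit Types (A B : set (borel x0)) (h : X -> R).

Lemma le_measure_integral (P : probability (borel x0) R) A h : measurable A ->
  continuous h -> (forall x, 0 <= h x) -> (forall x, A x -> 1 <= h x) ->
  (P A <= (Rintegral P setT h)%:E)%E.
Proof.
move=> mA ch h0 hA; rewrite /Rintegral fineK; last first.
  by apply: integrable_fin_num => //; exact: continuous_integrable.
rewrite -(setIT A) -integral_indic //; apply: ge0_le_integral => //.
- by apply/measurable_EFinP; exact: measurable_indic.
- by apply/measurable_EFinP; exact: continuous_borel.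
move=> x _; rewrite lee_fin indicE.
case: (boolP (x \in A)) => [/set_mem Ax|_]; [exact: hA|exact: h0].
Qed.

(** The inequality L h <= I h suffices, since applying it to -h gives the converse. After an affine
    change to values in [0, 1], cutting [h] into N layers proves it up to an error 1/N. *)
Lemma riesz_representation (L : prob_functional R X) :
  exists mu : probability (borel x0) R,
    forall h, continuous h -> Rintegral mu setT h = L h.
Proof.
pose mu : probability (borel x0) R := riesz_measure x0 L cX; exists mu.
pose I := integral_functional cX mu.
suff LI h : continuous h -> L h <= I h.
  move=> h ch; apply/le_anti; rewrite -/(I h) LI // andbT -lerN2.
  have -> : - L h = L (fun x => 0 - h x).
    by rewrite pfB ?pf_cst ?sub0r //; exact: cst_continuous.
  have -> : - I h = I (fun x => 0 - h x).
    by rewrite pfB ?pf_cst ?sub0r //; exact: cst_continuous.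
  by apply: LI; apply: continuousB_fun => //; exact: cst_continuous.
wlog h01 : h / forall x, 0 <= h x <= 1.
  move=> wh ch; have [M M0 hM] := compact_bounded_fun cX ch.
  have c0 : 0 < (2 * M)^-1 by rewrite invr_gt0 mulr_gt0.
  have affine (J : prob_functional R X) :
      J (fun x => (2 * M)^-1 * (h x + M)) = (2 * M)^-1 * (J h + M).
    rewrite pfZ ?pfD ?pf_cst //; first exact: cst_continuous.
    by apply: continuousD_fun => //; exact: cst_continuous.
  have := wh (fun x => (2 * M)^-1 * (h x + M)).
  rewrite !affine ler_pM2l // lerD2r; apply.
    move=> x; have := hM x; rewrite ler_norml => /andP[? ?].
    rewrite mulr_ge0 ?(ltW c0) //=; last by lra.
    by rewrite mulrC ler_pdivrMr ?mulr_gt0 //; lra.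
  by apply: continuousZ_fun; apply: continuousD_fun => //; exact: cst_continuous.
move=> ch; apply/ler_addgt0Pr => e e0.
have [n ne] : exists n, (n.+1%:R : R)^-1 < e.
  by have [//|n] := @ltr_add_invr R 0 e _; rewrite add0r; exists n.
pose N : R := n.+1%:R; have N0 : 0 < N by rewrite ltr0n.
(* Layer cake: N h is the sum of the slices, and the open set where a slice is
   positive lies in the set where the previous slice equals 1. *)
pose slice i (x : X) : R := Num.min 1 (Num.max 0 (N * h x - i%:R)).
have slice0 i x : 0 <= slice i x by rewrite le_min ler01 le_max lexx.
have cslice i : continuous (slice i).
  move=> x; apply: (@continuous_min R X (cst 1)); first exact: cvg_cst.
  apply: (@continuous_max R X (cst 0)); first exact: cvg_cst.
  apply: cvgB; last exact: cvg_cst.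
  by apply: continuousZ_fun.
have sliceS i x : 0 < slice i.+1 x -> 1 <= slice i x.
  rewrite /slice -[i.+1]addn1 natrD.
  by rewrite !minElt !maxElt; repeat case: ifP; lra.
have slice_sum x : \sum_(i < n.+1) slice i x = N * h x.
  have /andP[h0 h1] := h01 x.
  have t0 : 0 <= N * h x by rewrite mulr_ge0 // ltW.
  have tN : N * h x <= N by rewrite ler_piMr // ltW.
  suff -> k : \sum_(i < k) slice i x = Num.min k%:R (N * h x) by rewrite (min_idPr _).
  elim: k => [|k ih]; first by rewrite big_ord0 (min_idPl _).
  rewrite big_ord_recr /= ih /slice -[k.+1]addn1 natrD.
  have := ler0n R k.
  by rewrite !minElt !maxElt; repeat case: ifP; lra.
have sumL (J : prob_functional R X) : \sum_(i < n.+1) J (slice i) = N * J h.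
  by rewrite -pf_sum // -pfZ //; congr (J _); apply/funext => x.
have mV i : measurable (cozero x0 (slice i)) by exact: measurable_cozero.
have LV i : ((L (slice i))%:E <= mu (cozero x0 (slice i)))%E.
  apply: riesz_outer_ge => // x; first by move=> _; rewrite ge_min lexx.
  by rewrite /cozero /= => /negP; rewrite -leNgt.
(* Both sides are compared with the measure of the set where slice i+1 is positive. In the sum only
   slice 0 has no predecessor, which costs at most 1. *)
have LS i : L (slice i.+1) <= I (slice i).
  rewrite -lee_fin; apply: le_trans (LV _) _.
  by apply: le_measure_integral => // x; exact: sliceS.
have L0 : L (slice 0%N) <= 1.
  by rewrite -lee_fin; apply: le_trans (LV _) _; exact: probability_le1.
have : N * L h <= 1 + N * I h.
  rewrite -!sumL big_ord_recl lerD // big_ord_recr /= -[leLHS]addr0 lerD //.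
    by apply: ler_sum => i _; exact: LS.
  exact: (pf_ge0 I (cslice n)  (slice0 n)).
rewrite -ler_pdivlMl // mulrDr mulKf ?gt_eqF // mulr1 => /le_trans; apply.
by rewrite addrC lerD2l ltW.
Qed.

(** A segment is compact, so there is a cluster value; along an ultrafilter a cluster value is a
    limit, because a set or its complement is large. *)
Lemma ultralimit_exists {I : Type} (G : set_system I) (u : I -> R) M :
  UltraFilter G -> (forall i, `|u i| <= M) -> cvg (u @ G).
Proof.
move=> UG uM; have GP : ProperFilter G by exact: ultra_proper.
have GM : \forall i \near G, `[- M, M]%classic (u i).
  by apply: nearW => i; rewrite /= in_itv /= -ler_norml.
have [l [_ ul]] := @segment_compact R (- M) M (u @ G) _ GM.
apply/cvg_ex; exists l => U lU.
have [//|GU] := in_ultra_setVsetC (u @^-1` U) UG.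
by have [y [/= nUy Uy]] := ul (~` U) U GU lU.
Qed.

(** This is weak* compactness: one ultrafilter makes the values at all continuous functions converge
    together, and the laws of a probability functional pass to the limit. *)
Lemma probability_ultralimit {I : Type} (G : set_system I)
    (L : I -> prob_functional R X) : UltraFilter G ->
  exists mu : probability (borel x0) R,
    forall h, continuous h -> (fun i => L i h) @ G --> Rintegral mu setT h.
Proof.
move=> UG; have GP : ProperFilter G by exact: ultra_proper.
pose J h := lim ((fun i => L i h) @ G).
have Jcvg h : continuous h -> (fun i => L i h) @ G --> J h.
  move=> ch; have [M _ hM] := compact_bounded_fun cX ch.
  by apply: (@ultralimit_exists _ _ _ M) => // i; exact: pf_norm_le.
have JE h l : (fun i => L i h) @ G --> l -> J h = l by move=> /cvg_lim; exact.
have JD h k : continuous h -> continuous k -> J (fun x => h x + k x) = J h + J k.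
  move=> ch ck; apply: JE; under eq_fun do rewrite pfD //.
  by apply: cvgD; exact: Jcvg.
have JZ c h : continuous h -> J (fun x => c * h x) = c * J h.
  move=> ch; apply: JE; under eq_fun do rewrite pfZ //.
  by apply: cvgM; [exact: cvg_cst|exact: Jcvg].
have J0 h : continuous h -> (forall x, 0 <= h x) -> 0 <= J h.
  move=> ch h0; apply: limr_ge; first exact: Jcvg.
  by apply: nearW => i; exact: pf_ge0.
have J1 : J (fun=> 1) = 1.
  by apply: JE; under eq_fun do rewrite pf1; exact: cvg_cst.
have [mu muJ] := riesz_representation (ProbFunctional JD JZ J0 J1).
by exists mu => h ch; rewrite muJ //; exact: Jcvg.
Qed.

End representation.

(** * Continuous functions determining a probability *)

Section determination.
Context {R : realType} {X : metricType R} (x0 : X) (cX : compact [set: X]).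
Implicit Types (A B : set (borel x0)) (h rho : X -> R).

Definition ramp rho m x : R := Num.min 1 (m%:R * rho x).

Lemma continuous_ramp rho m : continuous rho -> continuous (ramp rho m).
Proof.
move=> crho x; apply: (@continuous_min R X (cst 1)); first exact: cvg_cst.
by apply: continuousZ_fun.
Qed.

(** The ramps increase pointwise to the indicator of the cozero set, so monotone convergence
    applies. *)
Lemma ramp_cvg (P : probability (borel x0) R) rho :
  continuous rho -> (forall x, 0 <= rho x) ->
  (Rintegral P setT (ramp rho m))%:E @[m --> \oo] --> P (cozero x0 rho).
Proof.
move=> crho rho0; rewrite -(setIT (cozero _ _)) -integral_indic //; last first.
  exact: measurable_cozero.
have ramp_le n x : ramp rho n x <= ramp rho n.+1 x.
  by rewrite le_min ge_min lexx /= ge_min orbC ler_wpM2r // ler_nat.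
have := @cvg_monotone_convergence _ (borel x0) R P setT measurableT
  (fun m x => (ramp rho m x)%:E).
have -> : (fun n => \int[P]_(x in setT) (ramp rho n x)%:E)%E =
    (fun m => (Rintegral P setT (ramp rho m))%:E).
  apply/funext => m; rewrite /Rintegral fineK //.
  apply: integrable_fin_num => //; apply: continuous_integrable => //.
  exact: continuous_ramp.
have -> : (\int[P]_(x in [set: borel x0]) limn (fun n => (ramp rho n x)%:E) =
    \int[P]_(x in setT) (\1_(cozero x0 rho) x)%:E)%E.
  apply: eq_integral => x _; apply/cvg_lim => //; rewrite indicE.
  have [/set_mem xr|/negP xr] := boolP (x \in cozero x0 rho).
    apply: cvg_near_cst; exists (Num.truncn (1 / rho x)).+1 => // n /= nr.
    rewrite /ramp (min_idPl _) // -ler_pdivrMr //.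
    rewrite (le_trans (ltW (truncnS_gt _))) // ler_nat //.
  have r0 : rho x = 0.
    apply/eqP; rewrite eq_le rho0 andbT leNgt; apply/negP => rx; apply: xr.
    by rewrite inE.
  apply: cvg_near_cst; apply: nearW => n.
  by rewrite /ramp r0 mulr0 (min_idPr _).
apply.
- by move=> n; apply/measurable_EFinP; apply: continuous_borel; exact: continuous_ramp.
- by move=> n x _; rewrite lee_fin le_min ler01 mulr_ge0.
- move=> x _; apply/nondecreasing_seqP => n; rewrite lee_fin; exact: ramp_le.
Qed.

(** Ramps of finite sums of the [w i] determine the measure of finite unions of basic cozero sets.
    Every open set is an increasing union of these, and the open sets form a generating family
    stable under intersection. *)
Lemma probability_determining :
  exists e : nat -> X -> R, (forall k, continuous (e k)) /\
    forall P Q : probability (borel x0) R,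
      (forall k, Rintegral P setT (e k) = Rintegral Q setT (e k)) ->
      forall A, measurable A -> P A = Q A.
Proof.
have [w [cw w0 wV]] := cozero_base x0 cX.
pose rho (s : seq nat) x := \sum_(i <- s) w i x.
have rho0 s x : 0 <= rho s x by exact: sumr_ge0.
have crho s : continuous (rho s).
  rewrite /rho; elim: s => [|i s ih].
    by under eq_fun do rewrite big_nil; exact: cst_continuous.
  by under eq_fun do rewrite big_cons; exact: continuousD_fun.
pose e k : X -> R := if unpickle k is Some (s, m) then ramp (rho s) m else cst 0.
exists e; split.
  move=> k; rewrite /e; case: (unpickle k) => [[s m]|]; last exact: cst_continuous.
  exact: continuous_ramp.
move=> P Q PQ.
have PQs s : P (cozero x0 (rho s)) = Q (cozero x0 (rho s)).
  have := @ramp_cvg P _ (crho s) (rho0 s).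
  have -> : (fun m => (Rintegral P setT (ramp (rho s) m))%:E) =
      (fun m => (Rintegral Q setT (ramp (rho s) m))%:E).
    by apply/funext => m; have := PQ (pickle (s, m)); rewrite /e pickleK => ->.
  by move=> /cvg_lim <- //; apply/cvg_lim => //; exact: ramp_cvg.
apply: (measure_unique (@open X : set (set (borel x0))) (fun=> setT)) => //.
- exact: openI.
- by move=> _; exact: openT.
- by apply/seteqP; split => // x _; exists 0%N.
- move=> V oV.
  pose good i := `[< forall y, 0 < w i y -> V y >].
  pose F n : set (borel x0) := cozero x0 (rho [seq i <- iota 0 n | good i]).
  have VF : V = \bigcup_n F n.
    apply/seteqP; split=> [x /(wV _ _ oV)[i wix iV]|x [n _]].
      exists i.+1 => //; rewrite /F /cozero /= (lt_le_trans wix) //.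
      have im : i \in [seq i <- iota 0 i.+1 | good i].
        by rewrite mem_filter mem_iota /= add0n ltnS leqnn andbT; exact/asboolP.
      by rewrite /rho (big_rem _ im) /= lerDl sumr_ge0.
    rewrite /F /cozero /= => /lt0r_neq0 /eqP r0; apply: contrapT => nVx; apply: r0.
    rewrite /rho big_filter big1 // => i /asboolP iV.
    by apply/eqP; rewrite eq_le w0 andbT leNgt; apply/negP => /iV.
  have mF n : measurable (F n) by exact: measurable_cozero.
  have Fnd : {homo F : n m / (n <= m)%N >-> (n <= m)%O}.
    apply/nondecreasing_seqP => n; apply/subsetPset => x; rewrite /F /cozero.
    have -> : iota 0 n.+1 = iota 0 n ++ [:: n] by rewrite -addn1 iotaD.
    rewrite filter_cat /rho /mkset big_cat /=.
    by move=> /lt_le_trans; apply; rewrite lerDl sumr_ge0.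
  rewrite VF.
  have := nondecreasing_cvg_mu (mu := P) mF (bigcupT_measurable _ mF) Fnd.
  have -> : P \o F = Q \o F by apply/funext => n; exact: PQs.
  move=> /cvg_lim <- //; apply/cvg_lim => //.
  exact: nondecreasing_cvg_mu (bigcupT_measurable _ mF) Fnd.
- by move=> _; rewrite (le_lt_trans (probability_le1 _ _)) // ltry.
Qed.

(** The right-hand side compares the integrals of [P] and of its image under [T]; a determining
    family turns their equality into equality of measures. *)
Lemma invariant_integral (T : X -> X) (P : probability (borel x0) R) :
  continuous T ->
  T_invariant T P <-> (forall h, continuous h ->
    Rintegral P setT (fun x => h (T x)) = Rintegral P setT h).
Proof.
move=> cT; have mT := continuous_borel_map x0 cT.
pose T' : {mfun borel x0 >-> borel x0} :=
  HB.pack (T : borel x0 -> borel x0) (isMeasurableFun.Build _ _ _ _ _ mT).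
have int h : continuous h ->
    Rintegral (distribution P T') setT h = Rintegral P setT (fun x => h (T x)).
  move=> ch; rewrite /Rintegral; congr fine.
  rewrite /distribution integral_pushforward //.
    by apply/measurable_EFinP; exact: continuous_borel.
  rewrite preimage_setT.
  apply: (@continuous_integrable R X x0 cX P (fun x => h (T x))) => x.
  by apply: continuous_comp; [exact: cT|exact: ch].
split=> [inv h ch|H].
  rewrite -int // /Rintegral; congr fine; apply: eq_measure_integral => A mA _.
  exact: inv.
have [e [ce eP]] := probability_determining.
move=> A mA; apply: (eP (distribution P T') P) => // k.
by rewrite int // H.
Qed.

End determination.

(** * Ergodic maximizing measures *)

Lemma ler_cvg {R : realType} {I : Type} (G : set_system I) (u : I -> R) (l b : R) :
  ProperFilter G -> u @ G --> l -> (\forall i \near G, b <= u i) -> b <= l.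
Proof. by move=> GP ul bu; apply: (cvgr_to_ge ul). Qed.

Section ergodic_maximization.
Context {R : realType} {X : metricType R} (x0 : X) (cX : compact [set: X]).
Implicit Types (h : X -> R) (P Q : probability (borel x0) R).

Lemma integral_convex P P1 P2 (a b : R) h : 0 <= a -> 0 <= b -> a + b = 1 ->
  (forall A, measurable A -> P A = a%:E * P1 A + b%:E * P2 A)%E ->
  continuous h ->
  Rintegral P setT h = a * Rintegral P1 setT h + b * Rintegral P2 setT h.
Proof.
(* Adding a bound [M] makes [h] nonnegative and shifts both sides by [M], as a + b = 1. *)
move=> a0 b0 ab PE; wlog h0 : h / forall x, 0 <= h x.
  move=> wh ch; have [M M0 hM] := compact_bounded_fun cX ch.
  have shift Q : Rintegral Q setT (fun x => h x + M) = Rintegral Q setT h + M.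
    have := pfD (integral_functional cX Q) ch (@cst_continuous _ _ M).
    by rewrite pf_cst.
  have hM0 x : 0 <= h x + M by have := hM x; rewrite ler_norml => /andP[]; lra.
  have := wh _ hM0 (continuousD_fun ch (@cst_continuous _ _ M)).
  by rewrite !shift (_ : b = 1 - a); last lra; lra.
move=> ch; have mh : measurable_fun setT (EFin \o (h : borel x0 -> R)).
  by apply/measurable_EFinP; exact: continuous_borel.
have fin Q : (\int[Q]_x (h x)%:E = (Rintegral Q setT h)%:E)%E.
  rewrite /Rintegral fineK //.
  by apply: integrable_fin_num => //; exact: continuous_integrable.
have hE (x : borel x0) : setT x -> (0 <= (h x)%:E)%E by rewrite lee_fin.
apply: EFin_inj; rewrite EFinD !EFinM -!fin.
transitivity (\int[measure_add (mscale (NngNum a0) P1) (mscale (NngNum b0) P2)]_x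
  (h x)%:E)%E; last first.
  rewrite ge0_integral_measure_add //; congr (_ + _)%E.
    exact: (@ge0_integral_mscale _ _ _ P1).
  exact: (@ge0_integral_mscale _ _ _ P2).
apply: eq_measure_integral => A mA _.
by rewrite -[RHS]/(measure_add (mscale _ P1) (mscale _ P2) A) measure_addE; exact: PE.
Qed.

Lemma conditional_probability P A : measurable A -> (0 < P A)%E ->
  exists Q, forall B, measurable B -> (P (B `&` A) = P A * Q B)%E.
Proof.
(* The second [P] is the fallback of the normalization for mass zero or infinity, excluded here. *)
move=> mA PA0; exists (mnormalize (mrestr P mA) P) => B mB.
have PA : P A \is a fin_num by exact: fin_num_measure.
rewrite /= /mnormalize /= /mrestr setTI gt_eqF //= lt_eqF /=; last by rewrite ltey_eq PA.
rewrite -[in X in (X * _)%E](fineK PA) muleCA -EFinM divff ?mule1 //.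
by rewrite gt_eqF // fine_gt0 // PA0 ltey_eq PA.
Qed.

Variables (T : X -> X) (cT : continuous T) (e : nat -> X -> R).
Hypothesis ce : forall k, continuous (e k).

(** Successive stages of the lexicographic maximization, each a face of the convex set of invariant
    measures. *)
Fixpoint face k : set (probability (borel x0) R) :=
  if k is k'.+1 then [set P | face k' P /\
    forall Q, face k' Q -> Rintegral Q setT (e k') <= Rintegral P setT (e k')]
  else [set P | T_invariant T P].

Lemma face_le k m P : (k <= m)%N -> face m P -> face k P.
Proof.
move=> km; rewrite -(subnKC km); elim: (m - k)%N => [|d ih]; first by rewrite addn0.
by rewrite addnS => -[/ih].
Qed.

(** Invariance is a family of equalities between integrals, and maximality a family of inequalities
    against fixed competitors; both survive weak* limits along a filter. *)
Lemma face_closed (G : set_system nat) (Ps : nat -> probability (borel x0) R) P k :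
  ProperFilter G ->
  (forall h, continuous h -> (fun n => Rintegral (Ps n) setT h) @ G --> Rintegral P setT h) ->
  (\forall n \near G, face k (Ps n)) -> face k P.
Proof.
move=> GP PsP; elim: k => [|k ih] Gk.
  apply/(invariant_integral cX _ cT) => h ch.
  apply: (@cvg_unique R^o (@Rhausdorff R) ((fun n => Rintegral (Ps n) setT h) @ G)).
    have /PsP : continuous (fun x => h (T x)).
      by move=> x; apply: continuous_comp; [exact: cT|exact: ch].
    apply: cvg_trans; apply: near_eq_cvg.
    by apply: filterS Gk => n /(invariant_integral cX _ cT); exact.
  exact: PsP.
split; first by apply: ih; apply: filterS Gk => n [].
move=> Q Qk; apply: (ler_cvg _ (PsP _ (@ce k))).
by apply: filterS Gk => n [_]; exact.
Qed.

(** An ultralimit of a maximizing sequence in [face k] remains in that face and attains the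
    supremum. *)
Lemma face_nonempty P k : T_invariant T P -> face k !=set0.
Proof.
move=> Pinv; elim: k => [|k [P0 P0k]]; first by exists P.
pose I Q := Rintegral Q setT (e k).
have [M M0 eM] := compact_bounded_fun cX (@ce k).
have IM Q : I Q <= M.
  by rewrite (le_trans (ler_norm _)) // (@pf_norm_le _ _ (integral_functional cX Q)).
have supI : has_sup (I @` face k).
  by split; [exists (I P0), P0|exists M => _ [Q _ <-]].
have /choice[Ps PsP] : forall n, exists Q, face k Q /\
    sup (I @` face k) - (n.+1%:R)^-1 < I Q.
  move=> n; have n0 : (0 : R) < (n.+1%:R)^-1 by rewrite invr_gt0.
  by have [_ [Q kQ <-] ?] := sup_adherent n0 supI; exists Q.
have [G [UG Goo]] := ultraFilterLemma eventually_filter.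
have [Q PsQ] := probability_ultralimit x0 cX (fun n => integral_functional cX (Ps n)) UG.
have GP : ProperFilter G by exact: ultra_proper.
exists Q; split.
  by apply: (face_closed GP PsQ); apply: nearW => n; have [] := PsP n.
move=> Q' kQ'; apply: (@le_trans _ _ (sup (I @` face k))).
  by apply: ub_le_sup; [exact: supI.2|exists Q'].
apply/ler_addgt0Pr => d d0; rewrite -lerBlDr.
apply: (ler_cvg _ (PsQ _ (@ce k))).
have [N Nd] : exists n, (n.+1%:R : R)^-1 < d.
  by have [//|n] := @ltr_add_invr R 0 d _; rewrite add0r; exists n.
apply: Goo; exists N => // n /= Nn; have [_ /ltW] := PsP n.
apply: le_trans; rewrite lerB // (le_trans _ (ltW Nd)) //.
by rewrite lef_pV2 ?posrE // ler_nat.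
Qed.

(** Faces decrease, so choosing a point in each and taking an ultralimit gives a point of all of
    them. *)
Lemma face_bigcap P : T_invariant T P -> exists Q, forall k, face k Q.
Proof.
move=> Pinv; have /choice[Ps PsP] := fun k => face_nonempty k Pinv.
have [G [UG Goo]] := ultraFilterLemma eventually_filter.
have [Q PsQ] := probability_ultralimit x0 cX (fun n => integral_functional cX (Ps n)) UG.
exists Q => k; apply: (face_closed (ultra_proper) PsQ).
by apply: Goo; exists k => // n /= kn; exact: face_le (PsP n).
Qed.

(* Faces are extreme, so a proper convex decomposition of a point of all faces
   stays in all faces, where the values of the integrals of [e k] are constant. *)
Lemma face_ergodic Q :
  (forall P1 P2, (forall k, Rintegral P1 setT (e k) = Rintegral P2 setT (e k)) ->
    forall A : set (borel x0), measurable A -> P1 A = P2 A) ->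
  (forall k, face k Q) -> ergodic T Q.
Proof.
move=> det fQ; split=> [|A mA TA]; first exact: (fQ 0%N).
have Qinv : T_invariant T Q := fQ 0%N.
have mAc : measurable (~` A) by exact: measurableC.
have TAc : T @^-1` (~` A) = ~` A by rewrite -preimage_setC TA.
have [A0|A0] := eqVneq (Q A) 0%E; first by left.
have [Ac0|Ac0] := eqVneq (Q (~` A)) 0%E.
  by right; have := probability_setC Q mAc; rewrite setCK Ac0 sube0.
exfalso.
have pos B : Q B != 0%E -> (0 < Q B)%E by rewrite lt0e measure_ge0 andbT.
(* If 0 < Q A < 1, conditioning on [A] and on its complement splits [Q] into two invariant
   measures. *)
have [Q1 Q1P] := conditional_probability mA (pos _ A0).
have [Q2 Q2P] := conditional_probability mAc (pos _ Ac0).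
have fin B : measurable B -> Q B \is a fin_num by exact: fin_num_measure.
have inv (B : set (borel x0)) (C : probability (borel x0) R) : measurable B -> T @^-1` B = B -> Q B != 0%E ->
    (forall D, measurable D -> Q (D `&` B) = Q B * C D)%E -> T_invariant T C.
  move=> mB TB B0 CP D mD.
  have mTD : measurable (T @^-1` D : set (borel x0)).
    by have := continuous_borel_map x0 cT measurableT D mD; rewrite setTI.
  have : (Q B * C (T @^-1` D) = Q B * C D)%E.
    rewrite -CP // -CP // -[RHS]Qinv; last exact: measurableI.
    by rewrite preimage_setI TB.
  have f1 := fin_num_measure C _ mTD; have f2 := fin_num_measure C _ mD.
  rewrite -(fineK f1) -(fineK f2) -(fineK (fin _ mB)) -!EFinM => -[].
  by move=> /mulfI ->; rewrite ?fine_eq0 ?fin.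
have Q1inv := inv _ _ mA TA A0 Q1P; have Q2inv := inv _ _ mAc TAc Ac0 Q2P.
pose a := fine (Q A); pose b := fine (Q (~` A)).
have aE : a%:E = Q A by rewrite fineK // fin.
have bE : b%:E = Q (~` A) by rewrite fineK // fin.
have a0 : 0 < a by rewrite -lte_fin aE; exact: pos.
have b0 : 0 < b by rewrite -lte_fin bE; exact: pos.
have ab : a + b = 1.
  by apply: EFin_inj; rewrite EFinD aE bE -measureU ?setICr // setUCr //; exact: probability_setT.
have QE B : measurable B -> (Q B = a%:E * Q1 B + b%:E * Q2 B)%E.
  move=> mB; rewrite aE bE -Q1P // -Q2P // -measureU.
  - by rewrite -setIUr setUCr setIT.
  - exact: measurableI.
  - exact: measurableI.
  - by rewrite setIACA setICr setI0.
have QI k := integral_convex (ltW a0) (ltW b0) ab QE (@ce k).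
have f12 k : face k Q1 /\ face k Q2.
  elim: k => [//|k [f1 f2]]; have [_ max] := fQ k.+1.
  have m1 := max _ f1; have m2 := max _ f2; have := QI k.
  set q := Rintegral Q setT (e k); set q1 := Rintegral Q1 setT (e k).
  set q2 := Rintegral Q2 setT (e k); rewrite -/q -/q1 in m1; rewrite -/q -/q2 in m2.
  move=> qE.
  (* Both terms are nonnegative by maximality of [Q], so both vanish. *)
  have /eqP : b * (q - q2) + a * (q - q1) = 0 by rewrite qE; move: ab; nra.
  rewrite paddr_eq0 ?mulr_ge0 ?subr_ge0 ?(ltW a0) ?(ltW b0) //.
  rewrite !mulf_eq0 (gt_eqF a0) (gt_eqF b0) /= !subr_eq0 => /andP[/eqP q2E /eqP q1E].
  split; split=> // Q' /max.
    by rewrite -/q -/q1 q1E.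
  by rewrite -/q -/q2 q2E.
have eq12 k : Rintegral Q1 setT (e k) = Rintegral Q2 setT (e k).
  have [[f1 M1] [f2 M2]] := f12 k.+1.
  by apply/le_anti; rewrite M1 ?M2.
(* [Q2] gives [A] mass 0; equality with [Q1] then forces Q A = 0, a contradiction. *)
have := Q1P _ mA; have := Q2P _ mA; rewrite setICr measure0 setIid.
move/esym/eqP; rewrite mule_eq0 (negbTE Ac0) /= -(det _ _ eq12 _ mA) => /eqP ->.
by rewrite mule0; apply/eqP.
Qed.

End ergodic_maximization.

Lemma ergodic_maximizer {R : realType} {X : metricType R} (x0 : X) (T : X -> X)
    (P : probability (borel x0) R) (h : X -> R) :
  compact [set: X] -> continuous T -> T_invariant T P -> continuous h ->
  exists2 Q : probability (borel x0) R, ergodic T Q &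
    Rintegral P setT h <= Rintegral Q setT h.
Proof.
move=> cX cT Pinv ch; have [e [ce det]] := probability_determining x0 cX.
(* Placing [h] first makes its integral the first quantity maximized; the rest still determines
   measures. *)
pose e' k := if k is k'.+1 then e k' else h.
have ce' k : continuous (e' k) by case: k => [|k]; [exact: ch|exact: ce].
have [Q fQ] := face_bigcap cX cT ce' Pinv.
exists Q; last by have [_] := fQ 1%N; exact.
apply: (face_ergodic cX cT ce') => // P1 P2 P12 A mA.
by apply: det => // k; have := P12 k.+1.
Qed.

(** * Asymptotically additive potentials *)

Section limn_esup.
Context {R : realType}.
Implicit Types (u : nat -> \bar R) (y : \bar R).

Lemma limn_esup_lt u y : (limn_esup u < y)%E ->
  exists N, forall n, (N <= n)%N -> (u n < y)%E.
Proof.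
rewrite /limn_esup /limf_esup => /ereal_inf_lt[_ [A [N _ NA] <-] Ay].
exists N => n Nn; apply: le_lt_trans Ay; apply: ereal_sup_ubound.
by exists n => //; exact: NA.
Qed.

Lemma limn_esup_ge u y : (forall N, exists2 n, (N <= n)%N & (y <= u n)%E) ->
  (y <= limn_esup u)%E.
Proof.
move=> H; rewrite leNgt; apply/negP => /limn_esup_lt[N HN].
by have [n /HN + yn] := H N; rewrite ltNge yn.
Qed.

Lemma limn_esup_gt u y : (y < limn_esup u)%E ->
  forall N, exists2 n, (N <= n)%N & (y < u n)%E.
Proof.
move=> yu N; apply: contrapT => H; move: yu; apply/negP; rewrite -leNgt.
apply: ge_ereal_inf; exists (ereal_sup (u @` [set n | (N <= n)%N])).
  by exists [set n | (N <= n)%N] => //; exists N.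
apply: ge_ereal_sup => _ [n /= Nn <-]; rewrite leNgt; apply/negP => yn.
by apply: H; exists n.
Qed.

End limn_esup.

Section additive_potentials.
Context {R : realType} {X : metricType R} (x0 : X) (cX : compact [set: X]).
Variables (T : X -> X) (cT : continuous T).
Implicit Types (h : X -> R) (F G : nat -> X -> R) (P : probability (borel x0) R).

Lemma continuous_iter n : continuous (iter n T).
Proof.
elim: n => [|n ih] x; first exact: cvg_id.
by apply: (@continuous_comp _ _ _ (iter n T) T); [exact: ih|exact: cT].
Qed.

Lemma continuous_birkhoff h n : continuous h -> continuous (birkhoff T h n).
Proof.
move=> ch; apply: (@continuous_sum_fun R X n (fun i x => h (iter i T x))) => i x.
by apply: continuous_comp; [exact: continuous_iter|exact: ch].
Qed.

Lemma birkhoff_lin (a b : R) h k n x :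
  birkhoff T (fun x => a * h x + b * k x) n x =
  a * birkhoff T h n x + b * birkhoff T k n x.
Proof. by rewrite /birkhoff big_split /= !mulr_sumr. Qed.

Lemma integral_birkhoff P h n : T_invariant T P -> continuous h ->
  Rintegral P setT (birkhoff T h n) = n%:R * Rintegral P setT h.
Proof.
move=> Pinv ch.
have inv i : Rintegral P setT (fun x => h (iter i T x)) = Rintegral P setT h.
  elim: i => [//|i <-]; move: (Pinv) => /(invariant_integral cX P cT) H.
  rewrite -(H (fun x => h (iter i T x))).
    by apply: eq_Rintegral => x _; rewrite -iterSr.
  by move=> x; apply: continuous_comp; [exact: continuous_iter|exact: ch].
have := @pf_sum _ _ (integral_functional cX P) n (fun i x => h (iter i T x)).
rewrite /= /birkhoff => -> => [|i x].
  by under eq_bigr do rewrite inv; rewrite sumr_const card_ord mulr_natl.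
by apply: continuous_comp; [exact: continuous_iter|exact: ch].
Qed.

Definition birkhoff_near F h (xi : R) := continuous h /\
  exists N, forall n, (N <= n)%N -> forall x, `|F n x - birkhoff T h n x| <= n%:R * xi.

(* [AAP] with the limsup of sup norms unfolded. *)
Definition birkhoff_approximable F :=
  (forall n, (0 < n)%N -> continuous (F n)) /\
  forall xi : R, 0 < xi -> exists h, birkhoff_near F h xi.

Lemma AAP_approximable F : AAP T F -> birkhoff_approximable F.
Proof.
move=> [cF HF]; split=> // xi /HF[h [ch /limn_esup_lt[N HN]]].
exists h; split=> //; exists N.+1 => n Nn x.
have n0 : 0 < n%:R :> R by rewrite ltr0n (leq_trans _ Nn).
rewrite mulrC -ler_pdivrMr // mulrC -lee_fin EFinM.
apply: le_trans (ltW (HN n (ltnW Nn))).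
by apply: lee_wpmul2l; [rewrite lee_fin invr_ge0 ltW|apply: ereal_sup_ubound; exists x].
Qed.

Lemma approximable_lin (a b : R) F G :
  birkhoff_approximable F -> birkhoff_approximable G ->
  birkhoff_approximable (fun n x => a * F n x + b * G n x).
Proof.
move=> [cF HF] [cG HG]; split=> [n n0|xi xi0].
  by apply: continuousD_fun; apply: continuousZ_fun; [exact: cF|exact: cG].
(* The summand 1 keeps the divisor positive when both coefficients vanish. *)
pose c := `|a| + `|b| + 1; have c0 : 0 < c.
  by rewrite ltr_wpDl // addr_ge0.
have [h [ch [N HN]]] := HF _ (divr_gt0 xi0 c0).
have [k [ck [M HM]]] := HG _ (divr_gt0 xi0 c0).
exists (fun x => a * h x + b * k x); split.
  by apply: continuousD_fun; exact: continuousZ_fun.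
exists (maxn N M) => n; rewrite geq_max => /andP[Nn Mn] x.
rewrite birkhoff_lin.
have -> : a * F n x + b * G n x - (a * birkhoff T h n x + b * birkhoff T k n x) =
  a * (F n x - birkhoff T h n x) + b * (G n x - birkhoff T k n x) by ring.
rewrite (le_trans (ler_normD _ _)) // !normrM.
apply: (@le_trans _ _ ((`|a| + `|b|) * (n%:R * (xi / c)))).
  by rewrite mulrDl lerD // ler_wpM2l // ?HN ?HM.
have -> : n%:R * xi = c * (n%:R * (xi / c)) by field; rewrite gt_eqF.
by rewrite ler_wpM2r ?lerDl // mulr_ge0 // divr_ge0 // ltW.
Qed.

Section invariant.
Variables (P : probability (borel x0) R) (Pinv : T_invariant T P).

Lemma average_near F h xi : (forall n, (0 < n)%N -> continuous (F n)) ->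
  birkhoff_near F h xi ->
  \forall n \near \oo, `|(n%:R)^-1 * Rintegral P setT (F n) - Rintegral P setT h| <= xi.
Proof.
move=> cF [ch [N HN]]; exists N.+1 => // n /= Nn.
have n0 : (0 < n)%N by exact: leq_trans Nn.
have nR : 0 < n%:R :> R by rewrite ltr0n.
have -> : Rintegral P setT h = (n%:R)^-1 * Rintegral P setT (birkhoff T h n).
  by rewrite integral_birkhoff // mulKf // gt_eqF.
rewrite -mulrBr normrM gtr0_norm ?invr_gt0 // ler_pdivrMl //.
have -> := esym (@pfB _ _ (integral_functional cX P) (F n) (birkhoff T h n) (cF _ n0)
  (continuous_birkhoff ch)).
apply: pf_norm_le => [|x]; last by apply: HN; exact: ltnW.
by apply: continuousB_fun; [exact: cF|exact: continuous_birkhoff].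
Qed.

(** The averages are eventually within any tolerance of a fixed integral of some [h], hence Cauchy.
    So the [limn] in [Fstar] is a genuine limit. *)
Lemma Fstar_cvg F : birkhoff_approximable F ->
  (n%:R)^-1 * Rintegral P setT (F n) @[n --> \oo] --> Fstar F P.
Proof.
move=> [cF HF].
suff : cvgn (fun n => (n%:R)^-1 * Rintegral P setT (F n)) by [].
apply/cauchy_cvgP; apply: cauchy_exP => d d0.
have d20 : 0 < d / 2 by rewrite divr_gt0.
have [h Hh] := HF _ d20; exists (Rintegral P setT h).
apply: filterS (average_near cF Hh) => n.
rewrite distrC /ball /= => /le_lt_trans; apply; lra.
Qed.

Lemma Fstar_near F h xi : birkhoff_approximable F -> birkhoff_near F h xi ->
  `|Fstar F P - Rintegral P setT h| <= xi.
Proof.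
move=> aF Fh; have Fn := average_near aF.1 Fh; have Fc := Fstar_cvg aF.
rewrite ler_distl; apply/andP; split.
  by apply: (ler_cvg _ Fc); apply: filterS Fn => n; rewrite ler_distl => /andP[].
rewrite -lerN2; apply: (ler_cvg _ (cvgN Fc)).
by apply: filterS Fn => n; rewrite ler_distl lerN2 => /andP[].
Qed.

Lemma Fstar_lin (a b : R) F G : birkhoff_approximable F -> birkhoff_approximable G ->
  Fstar (fun n x => a * F n x + b * G n x) P = a * Fstar F P + b * Fstar G P.
Proof.
move=> aF aG; apply: (cvg_lim (@Rhausdorff R)).
have H : (fun n => a * ((n%:R)^-1 * Rintegral P setT (F n)) +
    b * ((n%:R)^-1 * Rintegral P setT (G n))) @ \oo --> a * Fstar F P + b * Fstar G P.
  apply: cvgD; apply: cvgM; try exact: cvg_cst; exact: Fstar_cvg.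
apply: cvg_trans H; apply: near_eq_cvg; exists 1%N => // n /= n0.
have cF := aF.1 _ n0; have cG := aG.1 _ n0.
have -> : Rintegral P setT (fun x => a * F n x + b * G n x) =
    a * Rintegral P setT (F n) + b * Rintegral P setT (G n).
  have /= := pfD (integral_functional cX P) (@continuousZ_fun _ _ a _ cF)
    (@continuousZ_fun _ _ b _ cG).
  have /= := pfZ (integral_functional cX P) a cF.
  by have /= := pfZ (integral_functional cX P) b cG => -> -> ->.
by rewrite /=; ring.
Qed.

Lemma Fstar_ge F sigma : birkhoff_approximable F ->
  (forall n x, (0 < n)%N -> sigma <= (n%:R)^-1 * F n x) -> sigma <= Fstar F P.
Proof.
move=> aF Fs; apply: (ler_cvg _ (Fstar_cvg aF)); exists 1%N => // n /= n0.
have nR : 0 < n%:R :> R by rewrite ltr0n.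
rewrite -(pfZ (integral_functional cX P) _ (aF.1 _ n0)).
rewrite -[leLHS](pf_cst (integral_functional cX P)); apply: pf_le.
- exact: cst_continuous.
- by apply: continuousZ_fun; exact: aF.1.
- by move=> x; exact: Fs.
Qed.

(** By invariance the Birkhoff sum has mean [n] times the integral of [h], and some point reaches
    above any smaller value. *)
Lemma exists_birkhoff_gt h c n : continuous h -> c < Rintegral P setT h ->
  (0 < n)%N -> exists y, n%:R * c < birkhoff T h n y.
Proof.
move=> ch hc n0; apply: contrapT => H.
have nR : 0 < n%:R :> R by rewrite ltr0n.
have : Rintegral P setT (birkhoff T h n) <= n%:R * c.
  rewrite -(pf_cst (integral_functional cX P) (n%:R * c)).
  apply: (@pf_le _ _ (integral_functional cX P)).
  - exact: continuous_birkhoff.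
  - exact: cst_continuous.
  - by move=> x; rewrite leNgt; apply/negP => xc; apply: H; exists x.
by rewrite integral_birkhoff // ler_pM2l // leNgt hc.
Qed.

End invariant.

End additive_potentials.

(** * Specification and oscillation *)

(** Heine-Cantor, stated for all small [e] so that finitely many functions can share one radius. *)
Lemma uniformly_near {R : realType} {X : metricType R} (h : X -> R) (d : R) :
  compact [set: X] -> continuous h -> 0 < d ->
  \forall e \near 0^'+, forall x y, mdist x y <= e -> `|h x - h y| <= d.
Proof.
move=> cX ch d0.
have /compact_near_coveringP/(_ _ (0 : R)^'+
  (fun e x => forall y, mdist x y <= e -> `|h x - h y| <= d)) := cX.
move=> H; apply: filterS (H _ _); first by move=> e eP x; exact: eP.
move=> z _; have d20 : 0 < d / 2 by rewrite divr_gt0.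
have /metricType_numDomainType.nbhs_mdistP[r /= r0 rP] :
    \forall y \near z, `|h z - h y| < d / 2.
  by have /cvgrPdist_lt/(_ _ d20) := ch z.
have r20 : 0 < r / 2 by rewrite divr_gt0.
exists (ball z (r / 2), [set e | e < r / 2]).
  by split; [exact: nbhsx_ballx|exact: nbhs_right_lt].
move=> [x e] /= []; rewrite ballEmdist /= => zx er y xy.
have hx : `|h z - h x| < d / 2 by apply: rP => /=; lra.
have hy : `|h z - h y| < d / 2.
  apply: rP; rewrite /= (le_lt_trans (metric_triangle z x y)) // [ltRHS]splitr.
  by rewrite ltrD // (le_lt_trans xy).
have -> : h x - h y = (h z - h y) - (h z - h x) by ring.
by rewrite (le_trans (ler_normB _ _)) // [leRHS]splitr addrC lerD // ltW.
Qed.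

Section specification.
Context {R : realType} {X : metricType R} (cX : compact [set: X]).
Variables (T : X -> X) (cT : continuous T) (sT : specification T).

(** A cluster point of points tracking the first [k] segments tracks them all; the limit weakens the
    strict inequality. *)
Lemma specification_infinite (eps : R) : 0 < eps -> exists m : nat,
  forall (a b : nat -> nat) (xs : nat -> X),
    (forall j, (a j <= b j)%N) -> (forall j, (b j + m <= a j.+1)%N) ->
    exists x, forall j p, (p <= b j - a j)%N ->
      mdist (iter (p + a j) T x) (iter p T (xs j)) <= eps.
Proof.
move=> e0; have [m mP] := sT e0; exists m => a b xs ab bm.
have /choice[z zP] k := mP k a b xs (fun j _ => ab j) (fun j _ => bm j).
have [x [_ zx]] := @cX (z @ \oo) _ filterT.
exists x => j p pj; rewrite leNgt; apply/negP => far.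
have near_far : \forall u \near x, eps < mdist (iter (p + a j) T u) (iter p T (xs j)).
  have : (fun u => mdist (iter p T (xs j)) (iter (p + a j) T u)) @ x -->
      mdist (iter p T (xs j)) (iter (p + a j) T x).
    by apply: continuous_comp; [exact: continuous_iter|exact: continuous_mdist].
  rewrite metric_sym in far; move=> /cvgr_gt/(_ _ far).
  by apply: filterS => u; rewrite metric_sym.
have near_close : (z @ \oo) [set u | mdist (iter (p + a j) T u) (iter p T (xs j)) < eps].
  by exists j.+1 => // k /= jk; exact: zP.
have [u [/= u1 u2]] := zx _ _ near_close near_far.
by have := lt_trans u1 u2; rewrite ltxx.
Qed.

(* The tracking point visits, for each [i], blocks whose lengths exceed
   any multiple of the elapsed time, so each block dominates the Birkhoff sum
   up to its end. *)
Lemma birkhoff_oscillation q (h : 'I_q.+1 -> X -> R) (c : 'I_q.+1 -> R) :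
  (forall i, continuous (h i)) -> (forall i, 0 < c i) ->
  (forall i n, (0 < n)%N -> exists y, n%:R * (2 * c i) < birkhoff T (h i) n y) ->
  exists x, forall i N, exists n,
    [/\ (N <= n)%N, (0 < n)%N & n%:R * c i < birkhoff T (h i) n x].
Proof.
move=> ch c0 hc.
have [eps [e0 epsP]] : exists eps : R, 0 < eps /\ forall i x y, mdist x y <= eps ->
    `|h i x - h i y| <= c i / 2.
  have H : \forall e \near (0 : R)^'+, forall i x y, mdist x y <= e ->
      `|h i x - h i y| <= c i / 2.
    apply: filter_forall => i; apply: uniformly_near => //.
    by rewrite divr_gt0.
  have [e [e0 eP]] := filter_ex (filterI (nbhs_right_gt (0 : R)) H).
  by exists e.
have /choice[M MP] : forall i, exists M : R, forall x, `|h i x| <= M.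
  by move=> i; have [M _ HM] := compact_bounded_fun cX (ch i); exists M.
(* For a block of length l = K (a + 1) after elapsed time [a], the spare gain l c/2 exceeds a (M +
   c), the worst loss from the past. *)
have [K [K0 KP]] : exists K : nat, (0 < K)%N /\ forall i, M i + c i <= K%:R * (c i / 2).
  have H : \forall K \near \oo, forall i, M i + c i <= K%:R * (c i / 2).
    apply: filter_forall => i.
    have ci : 0 < c i / 2 by rewrite divr_gt0.
    near=> K; rewrite -ler_pdivrMr //; near: K; exact: nbhs_infty_ger.
  by have [K [? ?]] := filter_ex (filterI (nbhs_infty_gt 0) H); exists K.
have [m mP] := specification_infinite e0.
pose a := fix a j := if j is j'.+1 then (a j' + K * (a j').+1 + m)%N else 0%N.
pose l j := (K * (a j).+1)%N.
have l0 j : (0 < l j)%N by rewrite muln_gt0 K0.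
have aS j : a j.+1 = (a j + l j + m)%N by [].
have a_ge j : (j <= a j)%N.
  elim: j => [//|j ih]; rewrite aS -addnA -[j.+1]addn1 leq_add // (leq_trans (l0 j)) //.
  exact: leq_addr.
pose idx j : 'I_q.+1 := inord (j %% q.+1).
have /choice[y yP] j := hc (idx j) (l j) (l0 j).
(* The intervals include their right end, so a block of [l j] points ends at a j + l j - 1. *)
have [|j|x xP] := mP a (fun j => (a j + l j).-1) y.
- by move=> j; have := l0 j; case: (l j) => // n _; rewrite addnS leq_addr.
- by rewrite aS leq_add2r leq_pred.
(* Indices are visited cyclically; this block is at least the [N]-th and has index [i]. *)
exists x => i N; pose j := (N * q.+1 + i)%N.
have idxj : idx j = i by rewrite /idx /j modnMDl modn_small ?inord_val // ltn_ord.
have Nj : (N <= j)%N by rewrite /j (leq_trans (leq_pmulr N (ltn0Sn q))) // leq_addr.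
exists (a j + l j)%N; split.
- by rewrite (leq_trans Nj) // (leq_trans (a_ge j)) // leq_addr.
- by rewrite addn_gt0 l0 orbT.
rewrite /birkhoff big_split_ord /=.
have past : - ((a j)%:R * M i) <= \sum_(p < a j) h i (iter p T x).
  rewrite -mulrN mulr_natl -[X in _ *+ X]card_ord -sumr_const; apply: ler_sum => p _.
  by have := MP i (iter p T x); rewrite ler_norml => /andP[].
(* Tracking costs at most c/2 per step, leaving 3c/2 per step of the block. *)
have block : (l j)%:R * (2 * c i) - (l j)%:R * (c i / 2) <=
    \sum_(p < l j) h i (iter (a j + p) T x).
  have := yP j; rewrite idxj => /ltW yj.
  apply: (@le_trans _ _ (birkhoff T (h i) (l j) (y j) - (l j)%:R * (c i / 2))).
    by rewrite lerD2r.
  rewrite mulr_natl -[X in _ *+ X]card_ord -sumr_const -sumrB; apply: ler_sum => p _.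
  have pl : (p <= (a j + l j).-1 - a j)%N.
    have := ltn_ord p; have := l0 j; case: (l j) (p : nat) => // n p' _ p'n.
    by rewrite addnS /= addKn.
  have /epsP := xP _ _ pl; rewrite -[(p + a j)%N]addnC => /(_ i).
  by rewrite ler_norml => /andP[+ _]; lra.
apply: lt_le_trans (lerD past block).
have lE : (l j)%:R = K%:R * ((a j)%:R + 1) :> R by rewrite /l natrM -natr1.
have aR : 0 <= (a j)%:R :> R by [].
have M0 : 0 <= M i by rewrite (le_trans _ (MP i x)).
have := ler_wpM2r (addr_ge0 aR ler01) (KP i); have ci := c0 i.
have : 0 < (l j)%:R :> R by rewrite ltr0n.
rewrite natrD lE; nra.
Unshelve. all: by end_near. Qed.

(** With tolerance c = F_*/4, the integral of [h] is at least 3c > 2c; Birkhoff sums above n c then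
    leave [F] positive after an error of at most n c. *)
Lemma approximable_oscillation (x0 : X) q (F : 'I_q.+1 -> nat -> X -> R)
    (P : 'I_q.+1 -> probability (borel x0) R) :
  (forall i, birkhoff_approximable T (F i)) -> (forall i, T_invariant T (P i)) ->
  (forall i, 0 < Fstar (F i) (P i)) ->
  exists x, forall i N, exists n, [/\ (N <= n)%N, (0 < n)%N & 0 < F i n x].
Proof.
move=> aF Pinv F0; pose c i := Fstar (F i) (P i) / 4.
have c0 i : 0 < c i by rewrite divr_gt0.
have /choice[h hP] i := (aF i).2 _ (c0 i).
have ch i : continuous (h i) by exact: (hP i).1.
have [|x xP] := birkhoff_oscillation ch c0.
  move=> i n n0; apply: (exists_birkhoff_gt cX cT (Pinv i)) => //.
  have := Fstar_near cX cT (Pinv i) (aF i) (hP i); rewrite ler_distl => /andP[_].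
  by have := F0 i; rewrite /c; lra.
exists x => i N; have [_ [N' N'P]] := hP i.
have [n [Nn n0 nx]] := xP i (maxn N N'); exists n.
move: Nn; rewrite geq_max => /andP[Nn N'n]; split=> //.
by have := N'P _ N'n x; rewrite ler_distl => /andP[+ _]; lra.
Qed.

End specification.

(** * Empirical measures and ratios *)

Lemma lee_below {R : realType} (v M : \bar R) :
  (forall c : R, (c%:E < v)%E -> (c%:E <= M)%E) -> (v <= M)%E.
Proof.
move=> H; case: M H => [m| |] H; [|exact: leey|]; case: v H => [r| |] H; rewrite ?leNye //.
- rewrite lee_fin leNgt; apply/negP => mr.
  by have := H ((m + r) / 2); rewrite lte_fin lee_fin => /(_ ltac:(lra)); lra.
- by have := H (m + 1) (ltry _); rewrite lee_fin gerDl ler10.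
- by have := H (r - 1); rewrite lte_fin ltrBlDr ltrDl ltr01 => /(_ isT).
- by have := H 0 (ltry _).
Qed.

Section empirical.
Context {R : realType} {X : metricType R} (x0 : X) (cX : compact [set: X]).
Variables (T : X -> X) (cT : continuous T).

(** The index is shifted by one so that the average is over a nonempty orbit segment. *)
Definition empirical_functional (n : nat) (x : X) : prob_functional R X.
Proof.
apply: (@ProbFunctional R X (fun h => (n.+1%:R)^-1 * birkhoff T h n.+1 x)).
- by move=> h k _ _; rewrite -mulrDr /birkhoff big_split.
- by move=> c h _; rewrite mulrCA; congr (_ * _); rewrite /birkhoff mulr_sumr.
- by move=> h _ h0; rewrite mulr_ge0 // /birkhoff sumr_ge0.
- by rewrite /birkhoff sumr_const card_ord mulVf.
Defined.

(** The Birkhoff sums of h(Tx) - h(x) telescope, so their averages are at most 2M/n and vanish in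
    the limit. *)
Lemma Vset_invariant (x : X) (P : probability (borel x0) R) :
  Vset T x P -> T_invariant T P.
Proof.
move=> xP; apply/(invariant_integral cX P cT) => h ch.
have chT : continuous (fun x => h (T x)).
  by move=> y; apply: continuous_comp; [exact: cT|exact: ch].
pose k y := h (T y) - h y; have ck : continuous k by exact: continuousB_fun.
have := pfB (integral_functional cX P) chT ch; rewrite /= -/k => kE.
apply/eqP; rewrite -subr_eq0 -kE -normr_le0; apply/ler_addgt0Pr => e e0.
have [M M0 hM] := compact_bounded_fun cX ch.
have e20 : 0 < e / 2 by rewrite divr_gt0.
have [n [Nn n0 /(_ ord0)]] :=
  xP 1%N (fun=> k) (fun=> ck) (e / 2) e20 (Num.truncn (2 * M / (e / 2))).+1.
have nR : 0 < n%:R :> R by rewrite ltr0n.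
have tele : birkhoff T k n x = h (iter n T x) - h x.
  rewrite /birkhoff /k; elim: n {Nn n0 nR} => [|n ih]; first by rewrite big_ord0 subrr.
  by rewrite big_ord_recr /= ih; ring.
have small : `|(n%:R)^-1 * birkhoff T k n x| <= e / 2.
  rewrite normrM gtr0_norm ?invr_gt0 // ler_pdivrMl // tele.
  rewrite (le_trans (ler_normB _ _)) // (le_trans (lerD (hM _) (hM _))) //.
  have -> : M + M = 2 * M by ring.
  rewrite -ler_pdivrMr // (le_trans (ltW (truncnS_gt _))) //.
  by rewrite ler_nat.
move=> close; rewrite add0r.
set I := Rintegral P setT k in close *; set s := _^-1 * _ in close small.
have -> : I = s - (s - I) by ring.
by rewrite (le_trans (ler_normB _ _)) // [leRHS]splitr lerD // ltW.
Qed.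

(** The measure is an ultralimit of the empirical ones; j <= k j makes the times unbounded, and
    eventual lower bounds on averages are inherited. *)
Lemma Vset_along (x : X) (k : nat -> nat) : (forall j, (j <= k j)%N) ->
  exists P : probability (borel x0) R, Vset T x P /\
    forall (h : X -> R) r, continuous h ->
      (\forall j \near \oo, r <= empirical_functional (k j) x h) ->
      r <= Rintegral P setT h.
Proof.
move=> jk; have [G [UG Goo]] := ultraFilterLemma eventually_filter.
have GP : ProperFilter G by exact: ultra_proper.
have [P PG] := probability_ultralimit x0 cX (fun j => empirical_functional (k j) x) UG.
exists P; split=> [d h ch e e0 N|h r ch rh]; last first.
  by apply: (ler_cvg _ (PG _ ch)); exact: Goo.
have near_h : \forall j \near G, forall i,
    `|Rintegral P setT (h i) - empirical_functional (k j) x (h i)| < e.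
  by apply: filter_forall => i; have /cvgrPdist_lt := PG _ (ch i); exact.
have near_N : \forall j \near G, (N <= j)%N by apply: Goo; exists N.
have [j [hj Nj]] := filter_ex (filterI near_h near_N).
exists (k j).+1; split=> // [|i]; last by rewrite distrC; exact: hj.
by rewrite (leq_trans Nj) // (leq_trans (jk j)).
Qed.

End empirical.

(** * Comparing ratios with constants *)

Section ratio.
Context {R : realType} {X : metricType R} (x0 : X) (cX : compact [set: X]).
Variables (T : X -> X) (cT : continuous T) (f g : nat -> X -> R) (sigma : R).
Hypotheses (af : birkhoff_approximable T f) (ag : birkhoff_approximable T g).
Hypotheses (sigma0 : 0 < sigma)
  (g_ge : forall n x, (0 < n)%N -> sigma <= (n%:R)^-1 * g n x).

Lemma denominator_gt0 n x : (0 < n)%N -> 0 < g n x.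
Proof.
move=> n0; have nR : 0 < n%:R :> R by rewrite ltr0n.
by have := lt_le_trans sigma0 (g_ge x n0); rewrite pmulr_rgt0 // invr_gt0.
Qed.

Lemma Fstar_denominator_gt0 (P : probability (borel x0) R) : T_invariant T P ->
  0 < Fstar g P.
Proof.
by move=> Pinv; apply: lt_le_trans sigma0 _; exact: (Fstar_ge cX cT Pinv ag g_ge).
Qed.

(** Positivity encodes a strict comparison of f/g with [c]. The explicit coefficients match
    [approximable_lin] and [Fstar_lin]. *)
Definition above c n x := 1 * f n x + (- c) * g n x.
Definition below c n x := -1 * f n x + c * g n x.

Lemma approximable_above c : birkhoff_approximable T (above c).
Proof. exact: approximable_lin. Qed.

Lemma approximable_below c : birkhoff_approximable T (below c).
Proof. exact: approximable_lin. Qed.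

Lemma above_gt0 c n x : (0 < n)%N -> (0 < above c n x) = (c < f n x / g n x).
Proof.
by move=> n0; rewrite ltr_pdivlMr ?denominator_gt0 // /above mul1r mulNr subr_gt0.
Qed.

Lemma below_gt0 c n x : (0 < n)%N -> (0 < below c n x) = (f n x / g n x < c).
Proof.
move=> n0; rewrite ltr_pdivrMr ?denominator_gt0 // /below mulN1r addrC subr_gt0 //.
Qed.

Section invariant.
Variables (P : probability (borel x0) R) (Pinv : T_invariant T P).

Lemma Fstar_above_gt0 c : (0 < Fstar (above c) P) = (c < Fstar f P / Fstar g P).
Proof.
rewrite ltr_pdivlMr ?Fstar_denominator_gt0 //.
by rewrite (Fstar_lin cX cT Pinv 1 (- c) af ag) mul1r mulNr subr_gt0.
Qed.

Lemma Fstar_below_gt0 c : (0 < Fstar (below c) P) = (Fstar f P / Fstar g P < c).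
Proof.
rewrite ltr_pdivrMr ?Fstar_denominator_gt0 //.
by rewrite (Fstar_lin cX cT Pinv (-1) c af ag) mulN1r addrC subr_gt0.
Qed.

(** Let K = [above c]. Approximating [K] within K_*(P)/4 by [h] and maximizing the integral of [h]
    loses this error twice, so K_*(Q) >= K_*(P)/2 > 0. *)
Lemma exists_ergodic_ratio_gt c : c < Fstar f P / Fstar g P ->
  exists2 Q : probability (borel x0) R, ergodic T Q & c < Fstar f Q / Fstar g Q.
Proof.
rewrite -Fstar_above_gt0 => F0; have F40 : 0 < Fstar (above c) P / 4 by rewrite divr_gt0.
have [h hP] := (approximable_above c).2 _ F40.
have [Q eQ PQ] := ergodic_maximizer cX cT Pinv hP.1.
exists Q => //.
have := Fstar_near cX cT Pinv (approximable_above c) hP.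
have := Fstar_near cX cT eQ.1 (approximable_above c) hP.
rewrite !ler_distl => /andP[Q1 _] /andP[_ P1].
rewrite ltr_pdivlMr; last exact: Fstar_denominator_gt0 eQ.1.
have := Fstar_lin cX cT eQ.1 1 (- c) af ag; rewrite -/(above c); lra.
Qed.

End invariant.

(** Suppose the limit measure has ratio below [c] and [h] approximates [below c] within a quarter of
    its limit. The integral of [h] is then at least three quarters of that limit, yet at most one
    quarter, since [below c] is negative at the chosen times. *)
Lemma exists_Vset_ratio_ge x c :
  (c%:E < limn_esup (fun n : nat => (f n x / g n x)%:E))%E ->
  exists P : probability (borel x0) R,
    [/\ Vset T x P, T_invariant T P & c <= Fstar f P / Fstar g P].
Proof.
move=> /limn_esup_gt cf.
have /choice[k kP] : forall j, exists k, (j <= k)%N /\ 0 < above c k.+1 x.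
  (* Times from [j.+1] on are positive and fit the shifted index of the empirical functionals. *)
  move=> j; have [[//|n] jn] := cf j.+1; rewrite lte_fin => cn.
  by exists n; split=> //; rewrite above_gt0.
have [P [xP PP]] := Vset_along x0 cX T x (fun j => (kP j).1).
have Pinv := Vset_invariant cX cT xP.
exists P; split=> //; rewrite leNgt -Fstar_below_gt0 //; apply/negP => F0.
have F40 : 0 < Fstar (below c) P / 4 by rewrite divr_gt0.
have [h hP] := (approximable_below c).2 _ F40.
have := Fstar_near cX cT Pinv (approximable_below c) hP.
rewrite ler_distl => /andP[_ h1].
have [ch [N HN]] := hP.
(* [Vset_along] transfers lower bounds, so the upper bound on [h] is applied to -h. *)
have : - (Fstar (below c) P / 4) <= Rintegral P setT (fun x => -1 * h x).
  apply: PP; first exact: continuousZ_fun.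
  exists N => // j Nj; have [jk ab] := kP j.
  have Nk : (N <= (k j).+1)%N by rewrite (leq_trans Nj) // (leq_trans jk).
  have nR : 0 < (k j).+1%:R :> R by rewrite ltr0n.
  rewrite (pfZ (empirical_functional T (k j) x) _ ch) mulN1r lerN2 /=.
  rewrite ler_pdivrMl //.
  have := HN _ Nk x; rewrite ler_distl => /andP[+ _].
  have : below c (k j).+1 x = - above c (k j).+1 x by rewrite /below /above; ring.
  lra.
have := pfZ (integral_functional cX P) (-1) ch; rewrite /= => ->.
lra.
Qed.

End ratio.

(** * Comparison of the four suprema *)

Theorem theoremF (R : realType) (X : metricType R) (x0 : X) (T : X -> X)
    (f phi g psi : nat -> X -> R) (sigma : R) :
  compact [set: X] -> continuous T -> specification T ->
  AAP T f -> AAP T phi -> AAP T g -> AAP T psi ->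
  0 < sigma ->
  (forall n x, (0 < n)%N -> sigma <= (n%:R)^-1 * g n x) ->
  (forall n x, (0 < n)%N -> sigma <= (n%:R)^-1 * psi n x) ->
  (ereal_inf [set (Fstar phi mu / Fstar psi mu)%:E
               | mu in [set mu : probability (borel x0) R | T_invariant T mu]]
   < ereal_sup [set (Fstar phi mu / Fstar psi mu)%:E
               | mu in [set mu : probability (borel x0) R | T_invariant T mu]])%E ->
  let ratio := fun mu : probability (borel x0) R => (Fstar f mu / Fstar g mu)%:E in
  ereal_sup [set ratio mu | mu in [set mu | ergodic T mu]]
    = ereal_sup [set ratio mu | mu in [set mu | T_invariant T mu]] /\
  ereal_sup [set ratio mu | mu in [set mu | T_invariant T mu]]
    = ereal_sup [set ratio mu | mu in [set mu | exists2 x, Xhat phi psi x & Vset T x mu]] /\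
  ereal_sup [set ratio mu | mu in [set mu | exists2 x, Xhat phi psi x & Vset T x mu]]
    = ereal_sup [set limn_esup (fun n : nat => (f n x / g n x)%:E) | x in Xhat phi psi].
Proof.
move=> cX cT sT /AAP_approximable af /AAP_approximable aphi /AAP_approximable ag
  /AAP_approximable apsi sigma0 g_ge psi_ge gap ratio.
set S1 := ereal_sup [set ratio mu | mu in [set mu | ergodic T mu]].
set S2 := ereal_sup [set ratio mu | mu in [set mu | T_invariant T mu]].
set S3 := ereal_sup [set ratio mu | mu in [set mu | exists2 x, _ & _]].
set S4 := ereal_sup [set limn_esup _ | x in _].
have S12 : (S1 <= S2)%E.
  by apply: ge_ereal_sup => _ [mu [muinv _] <-]; apply: ereal_sup_ubound; exists mu.
have S21 : (S2 <= S1)%E.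
  apply: ge_ereal_sup => _ [mu muinv <-]; apply: lee_below => c; rewrite lte_fin.
  move=> /(exists_ergodic_ratio_gt cX cT af ag sigma0 g_ge muinv)[nu nuerg cnu].
  apply: (@le_trans _ _ (ratio nu)); first by rewrite lee_fin ltW.
  by apply: ereal_sup_ubound; exists nu.
have S32 : (S3 <= S2)%E.
  apply: ge_ereal_sup => _ [mu [x _ /(Vset_invariant cX cT) muinv] <-].
  by apply: ereal_sup_ubound; exists mu.
have S43 : (S4 <= S3)%E.
  apply: ge_ereal_sup => _ [x xX <-]; apply: lee_below => c.
  move=> /(exists_Vset_ratio_ge x0 cX cT af ag sigma0 g_ge)[mu [xmu _ cmu]].
  apply: (@le_trans _ _ (ratio mu)); first by rewrite lee_fin.
  by apply: ereal_sup_ubound; exists mu => //; exists x.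
have S24 : (S2 <= S4)%E.
  apply: ge_ereal_sup => _ [mu muinv <-]; apply: lee_below => c; rewrite lte_fin => cmu.
  have [_ [mu2 mu2inv <-] gap2] := ereal_sup_gt gap.
  have [_ [mu1 mu1inv <-] gap1] := ereal_inf_lt gap2.
  set r1 := Fstar phi mu1 / _ in gap1; set r2 := Fstar phi mu2 / _ in gap1 gap2.
  rewrite lte_fin in gap1.
  (* The levels [a] and [b] trisect the gap between the two ratios. *)
  pose a := (2 * r1 + r2) / 3; pose b := (r1 + 2 * r2) / 3.
  have r1a : r1 < a by rewrite /a; lra.
  have ab : a < b by rewrite /a /b; lra.
  have br2 : b < r2 by rewrite /b; lra.
  pose F (i : 'I_3) := nth (above f g c) [:: above f g c; below phi psi a; above phi psi b] i.
  pose P (i : 'I_3) := nth mu [:: mu; mu1; mu2] i.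
  have [i|i|i|x xP] := @approximable_oscillation R X cX T cT sT x0 2 F P.
  - case: i => [[|[|[|//]]] i3]; rewrite /F /=.
    + exact: approximable_above.
    + exact: approximable_below.
    + exact: approximable_above.
  - by case: i => [[|[|[|//]]] i3].
  - case: i => [[|[|[|//]]] i3]; rewrite /F /P /=.
    + by rewrite (Fstar_above_gt0 cX cT af ag sigma0 g_ge).
    + by rewrite (Fstar_below_gt0 cX cT aphi apsi sigma0 psi_ge).
    + by rewrite (Fstar_above_gt0 cX cT aphi apsi sigma0 psi_ge).
  (* A limit would be at most [a] and at least [b], since the quotients fall below [a] and rise
     above [b] infinitely often. *)
  have xX : Xhat phi psi x.
    move=> [l phil].
    have la : l <= a.
      rewrite leNgt; apply/negP => /(cvgr_gt _ phil)[N _ HN].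
      have [n [Nn n0]] := xP (inord 1) N.
      rewrite /F inordK //= (below_gt0 _ sigma0 psi_ge) // ltNge.
      by rewrite ltW //; exact: HN.
    have : b <= l.
      rewrite leNgt; apply/negP => /(cvgr_lt _ phil)[N _ HN].
      have [n [Nn n0]] := xP (inord 2) N.
      rewrite /F inordK //= (above_gt0 _ sigma0 psi_ge) // ltNge.
      by rewrite ltW //; exact: HN.
    by rewrite leNgt (le_lt_trans la ab).
  apply: (@le_trans _ _ (limn_esup (fun n : nat => (f n x / g n x)%:E))); last first.
    by apply: ereal_sup_ubound; exists x.
  apply: limn_esup_ge => N; have [n [Nn n0]] := xP (inord 0) N.
  rewrite /F inordK //= (above_gt0 _ sigma0 g_ge) // => /ltW cn.
  by exists n.
(* The cycle S2 <= S4 <= S3 <= S2 yields the last two equalities. *)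
split; last split; apply/le_anti/andP; split=> //.
- exact: le_trans S43.
- exact: le_trans S24.
Qed.
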